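(* Let $P$ be the law of the reference regime-switching process, let $\rho\in\mathcal P(\mathbb R^d\times\mathcal I)$ and $\mu_{\mathrm p}\in\mathcal P(\mathbb R^d)$, and let $\bar P_{0,T}:=P\circ(Z_0,X_T)^{-1}$. Assume $$H(\rho\otimes\mu_{\mathrm p}\mid\bar P_{0,T})<\infty\quad\text{and}\quad\bar P_{0,T}\big|_{\operatorname{supp}(\rho\otimes\mu_{\mathrm p})}\ll\rho\otimes\mu_{\mathrm p},$$ and let $$\bar p_i(x,y):=\frac{d\bigl(\bar P_{0,T}|_{\operatorname{supp}(\rho\otimes\mu_{\mathrm p})}\bigr)}{d(\rho\otimes\mu_{\mathrm p})}\bigl((x,i),y\bigr).$$ Then the partially observed static problem $$\inf\bigl\{H(\pi\mid P_{0,T}):\pi\in\mathcal P((\mathbb R^d\times\mathcal I)^2),\ \pi\circ Z_0^{-1}=\rho,\ \pi\circ X_T^{-1}=\mu_{\mathrm p}\bigr\}$$ admits a unique optimal solution $\pi^{\rho,\mu_{\mathrm p}}\ll P_{0,T}$, characterized as follows. There exist nonnegative measurable functions $(\tilde f_i)_{i\in\mathcal I}$ and $\tilde g$ on $\mathbb R^d$, unique (modulo null sets of $\rho_i$ and $\mu_{\mathrm p}$ respectively) up to the transformation $(\tilde f,\tilde g)\sim(\lambda\tilde f,\lambda^{-1}\tilde g)$, $\lambda>0$, such that $$\frac{d\pi^{\rho,\mu_{\mathrm p}}}{dP_{0,T}}(z_0,z_T)=\tilde f_{i_0}(x_0)\,\tilde g(x_T)\quad\text{for }\pi^{\rho,\mu_{\mathrm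 p}}\text{-a.e. }(z_0,z_T)=((x_0,i_0),(x_T,i_T)).$$ Moreover, $(\tilde f_i)_{i\in\mathcal I}$ and $\tilde g$ solve $$\left\{\begin{aligned}1&=\tilde f_i(x)\int_{\mathbb R^d}\bar p_i(x,y)\tilde g(y)\,\mu_{\mathrm p}(dy),&&\rho_i\text{-a.e. }x,\quad i\in\mathcal I,\\1&=\tilde g(y)\sum_{i\in\mathcal I}\int_{\mathbb R^d}\bar p_i(x,y)\tilde f_i(x)\,\rho_i(dx),&&\mu_{\mathrm p}\text{-a.e. }y.\end{aligned}\right.$$ Equivalently, the optimal projected endpoint coupling $\gamma^{\rho,\mu_{\mathrm p}}:=(\mathrm{id}_E\times\mathrm{pr}_{\mathbb R^d})_\#\pi^{\rho,\mu_{\mathrm p}}$, where $\mathrm{pr}_{\mathbb R^d}(y,j)=y$, is given componentwise by $$\gamma_i^{\rho,\mu_{\mathrm p}}(dx,dy)=\tilde f_i(x)\,\bar p_i(x,y)\,\tilde g(y)\,\rho_i(dx)\,\mu_{\mathrm p}(dy),\qquad i\in\mathcal I.$$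
   Context: Fix $T>0$, $d\ge1$, a finite set $\mathcal I=\{1,\dots,m\}$, and $E:=\mathbb R^d\times\mathcal I$. Reference process: $Z_t=(X_t,I_t)$, $t\in[0,T]$, is an $E$-valued Markov process with $dX_t=b_{I_t}(t,X_t)\,dt+\sigma_{I_t}(t,X_t)\,dW_t$ ($W$ a $d$-dimensional Brownian motion) and $\mathbb P(I_{t+h}=j\mid I_t=i,X_t=x)=\lambda_{ij}(t,x)h+o(h)$ as $h\downarrow0$ for $j\ne i$, with $b_i:[0,T]\times\mathbb R^d\to\mathbb R^d$, $\sigma_i:[0,T]\times\mathbb R^d\to\mathbb R^{d\times d}$, $\lambda_{ij}:[0,T]\times\mathbb R^d\to\mathbb R_+$ (jumps change only $I$, not $X$). $P$ is its law on $\Omega_T=C([0,T];\mathbb R^d)\times D([0,T];\mathcal I)$ and $P_{0,T}:=P\circ(Z_0,Z_T)^{-1}$. On $E\times E$, $Z_0$ denotes the first coordinate and $X_T$ denotes the continuous component of the second coordinate $Z_T=(X_T,I_T)$. For a measure $\eta$ on $E$, $\eta_i(A):=\eta(A\times\{i\})$; for a measure $\gamma$ on $E\times\mathbb R^d$, $\gamma_i(A\times B):=\gamma((A\times\{i\})\times B)$. $H(\alpha\mid\beta)=\int\log\frac{d\alpha}{d\beta}\,d\alpha$ if $\alpha\ll\beta$, $+\infty$ otherwise. *)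

(* Defs.v *)
From HB Require Import structures.
From mathcomp Require Import all_boot all_order all_algebra.
From mathcomp Require Import all_classical all_reals all_analysis measurable_realfun.
Set Implicit Arguments.
Unset Strict Implicit.
Unset Printing Implicit Defensive.
Import Order.TTheory GRing.Theory Num.Theory.
Import numFieldNormedType.Exports.
Local Open Scope classical_set_scope.
Local Open Scope ring_scope.

(* The finite set I = {1,...,m+1} is 'I_m.+1 (measurable types are pointed in
   the library, hence nonempty), with its discrete topology and sigma-algebra. *)
HB.instance Definition _ (m : nat) := isPointed.Build 'I_m.+1 ord0.
HB.instance Definition _ (m : nat) := hasNbhs.Build 'I_m.+1 principal_filter.
HB.instance Definition _ (m : nat) := Discrete_ofNbhs.Build 'I_m.+1 erefl.
HB.instance Definition _ (m : nat) :=
  @isMeasurable.Build default_measure_display 'I_m.+1 discrete_measurable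
    discrete_measurable0 discrete_measurableC discrete_measurableU.

(* Borel sigma-algebra on matrices, in particular on R^n = 'rV[R]_n. *)
HB.instance Definition _ (R : realType) (p q : nat) :=
  Measurable.copy 'M[R]_(p, q) (g_sigma_algebraType (@open 'M[R]_(p, q))).

Notation state R n m := ('rV[R]_n * 'I_m.+1)%type.

Section path_space.
Context {R : realType}.

Definition clamp (T t : R) : R := Num.min (Num.max 0 t) T.

Definition cadlag (U : topologicalType) (f : R -> U) :=
  forall t, (f s @[s --> t^'+] --> f t) /\
            exists l : U, f s @[s --> t^'-] --> l.

(* C([0,T]; R^n) x D([0,T]; I).  A path on [0,T] is identified with its
   extension to R by constants, i.e. with a path factoring through [clamp T];
   right-continuity at T and existence of a left limit at 0 are then void. *)
Record path_space (T : R) (n m : nat) := PathSpace {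
  path_fun :> R -> state R n m;
  path_clamp : forall t, path_fun t = path_fun (clamp T t);
  path_continuous : continuous (fun t => (path_fun t).1);
  path_cadlag : cadlag (fun t => (path_fun t).2) }.

End path_space.

Section path_space_measurable.
Context {R : realType} (T : R) (n m : nat).

HB.instance Definition _ := gen_eqMixin (path_space T n m).
HB.instance Definition _ := gen_choiceMixin (path_space T n m).

Let cst_cadlag : cadlag (fun _ : R => (0 : 'rV[R]_n, ord0 : 'I_m.+1).2).
Proof. by move=> t; split; [|exists ord0]; exact: cvg_cst. Qed.

Let cst_continuous : continuous (fun _ : R => (0 : 'rV[R]_n, ord0 : 'I_m.+1).1).
Proof. by move=> t; exact: cvg_cst. Qed.

HB.instance Definition _ := isPointed.Build (path_space T n m)
  (@PathSpace R T n m (fun=> (0, ord0)) (fun=> erefl)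
    cst_continuous cst_cadlag).

(* The sigma-algebra generated by the coordinate maps, which is the Borel
   sigma-algebra of C x D. *)
Definition path_coordinates : set (set (path_space T n m)) :=
  \bigcup_(t in [set: R])
    preimage_set_system setT (fun w : path_space T n m => w t) measurable.

HB.instance Definition _ := Measurable.copy (path_space T n m)
  (g_sigma_algebraType path_coordinates).

Lemma measurable_coordinate (t : R) :
  measurable_fun setT (fun w : path_space T n m => w t).
Proof.
move=> _ B mB; rewrite setTI; apply: sub_sigma_algebra.
by exists t => //; exists B => //; rewrite setTI.
Qed.

Definition endpoints (w : path_space T n m) : state R n m * state R n m :=
  (w 0, w T).

Definition observed_endpoints (w : path_space T n m)
  : state R n m * 'rV[R]_n := (w 0, (w T).1).

Lemma measurable_endpoints : measurable_fun setT endpoints.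
Proof. by apply: measurable_fun_pair; exact: measurable_coordinate. Qed.

Lemma measurable_observed_endpoints : measurable_fun setT observed_endpoints.
Proof.
apply: measurable_fun_pair; first exact: measurable_coordinate.
by apply: measurableT_comp; [exact: measurable_fst|exact: measurable_coordinate].
Qed.

HB.instance Definition _ :=
  isMeasurableFun.Build _ _ _ _ endpoints measurable_endpoints.
HB.instance Definition _ :=
  isMeasurableFun.Build _ _ _ _ observed_endpoints measurable_observed_endpoints.

Variable P : probability (path_space T n m) R.

(* P_{0,T} = P o (Z_0, Z_T)^{-1} *)
Definition endpoint_law : probability (state R n m * state R n m)%type R :=
  distribution P endpoints.

(* \bar P_{0,T} = P o (Z_0, X_T)^{-1} *)
Definition observed_law : probability (state R n m * 'rV[R]_n)%type R :=
  distribution P observed_endpoints.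

End path_space_measurable.

Section stochastic_calculus.
Context {R : realType} (T : R) {dO : measure_display} {O : measurableType dO}.
Variable Pr : probability O R.
Local Notation leb := (@lebesgue_measure R).

Definition measurable_wrt (G : set (set O)) {dU} {U : measurableType dU}
    (f : O -> U) :=
  preimage_set_system setT f measurable `<=` G.

Definition filtration (F : R -> set (set O)) :=
  (forall t, t \in `[0, T] ->
     sigma_algebra setT (F t) /\ F t `<=` measurable) /\
  (forall s t, 0 <= s -> s <= t -> t <= T -> F s `<=` F t).

Definition adapted (F : R -> set (set O)) {dU} {U : measurableType dU}
    (Y : R -> O -> U) :=
  forall t, t \in `[0, T] -> measurable_wrt (F t) (Y t).

(* The product formula says at once that W_t - W_s is independent of F_s and
   that its law is the centred Gaussian with covariance (t - s) Id
   ([normal_prob] takes the standard deviation). *)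
Definition brownian_motion (n : nat) (F : R -> set (set O))
    (W : R -> O -> 'rV[R]_n) :=
  [/\ adapted F W,
      {ae Pr, forall o, W 0 o = 0},
      (forall o, {within `[0, T], continuous (W^~ o)}) &
      forall s t (A : set O) (B : 'I_n -> set R),
        0 <= s -> s < t -> t <= T -> F s A -> (forall k, measurable (B k)) ->
        Pr (A `&` [set o | forall k, B k ((W t o - W s o) 0 k)])
        = (Pr A * \prod_(k < n) normal_prob 0 (Num.sqrt (t - s)) (B k))%E].

(* The integrand sum_{k < sp_size} sp_val k 1_{(sp_time k, sp_time k.+1]}. *)
Record simple_process (n : nat) (F : R -> set (set O)) := SimpleProcess {
  sp_size : nat;
  sp_time : nat -> R;
  sp_val : nat -> O -> 'M[R]_n;
  sp_time_itv : forall k, (k <= sp_size)%N -> sp_time k \in `[0, T];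
  sp_time_le : forall k, (k < sp_size)%N -> sp_time k <= sp_time k.+1;
  sp_val_wrt : forall k, (k < sp_size)%N ->
    measurable_wrt (F (sp_time k)) (sp_val k);
  sp_val_bounded : exists C : R,
    forall k o, (k < sp_size)%N -> `|sp_val k o| <= C }.

Definition simple_fun n F (H : simple_process n F) (t : R) (o : O)
  : 'M[R]_n :=
  \sum_(k < sp_size H | (sp_time H k < t <= sp_time H k.+1)) sp_val H k o.

(* Vectors are rows, so the product sigma dW reads dW *m sigma^T. *)
Definition simple_integral n F (H : simple_process n F) (W : R -> O -> 'rV[R]_n)
    (t : R) (o : O) : 'rV[R]_n :=
  \sum_(k < sp_size H)
    (W (Num.min (sp_time H k.+1) t) o - W (Num.min (sp_time H k) t) o)
      *m (sp_val H k o)^T.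

Definition energy n (G : R -> O -> 'M[R]_n) (o : O) : \bar R :=
  (\int[leb]_(s in `[0%R, T]) (\sum_(i < n) \sum_(j < n) (G s o i j) ^+ 2)%:E)%E.

(* M_t = int_0^t G dW for t in [0, T] (Ito integral): limit in probability of
   the integrals of simple processes approximating G in L^2([0,T]) in
   probability. *)
Definition ito_integral n F (W : R -> O -> 'rV[R]_n) (G : R -> O -> 'M[R]_n)
    (M : R -> O -> 'rV[R]_n) :=
  (forall t, t \in `[0, T] -> measurable_fun setT (M t)) /\
  exists H : nat -> simple_process n F,
    (forall e : R, 0 < e ->
       Pr [set o | (e%:E < energy (fun s o => simple_fun (H k) s o - G s o)%R o)%E]
         @[k --> \oo] --> 0%E) /\
    (forall t, t \in `[0, T] -> forall e : R, 0 < e ->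
       Pr [set o | e < `|simple_integral (H k) W t o - M t o|]
         @[k --> \oo] --> 0%E).

(* dX = b_I(t, X) dt + sigma_I(t, X) dW on [0, T], with (X, I) = Z. *)
Definition solves_sde n m (b : 'I_m.+1 -> R -> 'rV[R]_n -> 'rV[R]_n)
    (sigma : 'I_m.+1 -> R -> 'rV[R]_n -> 'M[R]_n)
    (F : R -> set (set O)) (W : R -> O -> 'rV[R]_n) (Z : R -> O -> state R n m) :=
  let drift s o := b (Z s o).2 s (Z s o).1 in
  let vol s o := sigma (Z s o).2 s (Z s o).1 in
  [/\ forall i, measurable_fun (`[0, T] `*` setT)
        (fun tx : R * 'rV[R]_n => b i tx.1 tx.2) /\
        measurable_fun (`[0, T] `*` setT)
        (fun tx : R * 'rV[R]_n => sigma i tx.1 tx.2),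
      {ae Pr, forall o, forall k,
        leb.-integrable `[0, T] (fun s => (drift s o 0 k)%:E)},
      {ae Pr, forall o, (energy vol o < +oo)%E} &
      exists M, ito_integral F W vol M /\
        {ae Pr, forall o, forall t, t \in `[0, T] ->
          (Z t o).1 = (Z 0 o).1
            + \row_(k < n) Rintegral leb `[0, t] (fun s => drift s o 0 k)
            + M t o}].

End stochastic_calculus.

Section reference_process.
Context {R : realType} {T : R} {n m : nat}.
Local Notation E := (state R n m).
Variables (b : 'I_m.+1 -> R -> 'rV[R]_n -> 'rV[R]_n)
          (sigma : 'I_m.+1 -> R -> 'rV[R]_n -> 'M[R]_n)
          (lambda : 'I_m.+1 -> 'I_m.+1 -> R -> 'rV[R]_n -> R)
          (P : probability (path_space T n m) R).

(* sigma(Z_r, 0 <= r <= s) *)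
Definition history (s : R) : set (set (path_space T n m)) :=
  <<s \bigcup_(r in `[0, s])
        preimage_set_system setT (fun w : path_space T n m => w r) measurable >>.

Definition transition_function (kappa : R -> R -> R.-pker E ~> E) :=
  forall s t (A : set (path_space T n m)) (B : set E),
    0 <= s -> s <= t -> t <= T -> history s A -> measurable B ->
    P (A `&` [set w | B (w t)]) = (\int[P]_(w in A) kappa s t (w s) B)%E.

(* P(I_{t+h} = j | I_t = i, X_t = x) = lambda_ij(t, x) h + o(h), h -> 0+ *)
Definition jump_rates (kappa : R -> R -> R.-pker E ~> E) :=
  forall t, 0 <= t -> t < T -> forall i j, j != i -> forall x,
    h^-1 * fine (kappa t (t + h) (x, i) [set z | z.2 = j])
      @[h --> 0^'+] --> lambda i j t x.

(* P is the law of a Markov process Z = (X, I) with X solving the SDE with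
   coefficients b_I, sigma_I and I jumping at rates lambda_ij(t, X_t).  The
   Markov property is with respect to the process's own history. *)
Definition regime_switching_law :=
  (exists kappa, transition_function kappa /\ jump_rates kappa) /\
  exists (dO : measure_display) (O : measurableType dO) (Pr : probability O R)
      (F : R -> set (set O)) (W : R -> O -> 'rV[R]_n)
      (Z : {mfun O >-> path_space T n m}),
    [/\ filtration T F,
        brownian_motion T Pr F W,
        adapted T F (fun t o => Z o t),
        solves_sde T Pr b sigma F W (fun t o => Z o t) &
        forall A, measurable A -> P A = Pr (Z @^-1` A)].

End reference_process.

Section entropy.
Context {R : realType} {dU : measure_display} {U : measurableType dU}.
Local Open Scope ereal_scope.

Definition RN_derivative (alpha beta : probability U R) : U -> \bar R :=
  Radon_Nikodym (charge_of_finite_measure alpha) beta.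

Definition relative_entropy (alpha beta : probability U R) : \bar R :=
  if `[< alpha `<< beta >]
  then \int[alpha]_z lne (RN_derivative alpha beta z) else +oo.

(* f is a version of the Radon-Nikodym derivative d nu / d mu. *)
Definition is_density (nu mu : set U -> \bar R) (f : U -> \bar R) :=
  [/\ measurable_fun setT f, (forall z, 0 <= f z) &
      forall A, measurable A -> nu A = \int[mu]_(z in A) f z].

End entropy.

Definition msupport {R : realType} {U : topologicalType}
    (mu : set U -> \bar R) : set U :=
  [set z | forall V : set U, open V -> V z -> (0 < mu V)%E].

Definition restriction {R : realType} {U : Type} (mu : set U -> \bar R)
  (D : set U) : set U -> \bar R := fun A => mu (A `&` D).

Section regime_component.
Context {R : realType} {n m : nat}.
Variables (eta : {finite_measure set (state R n m) -> \bar R}) (i : 'I_m.+1).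

(* eta_i(A) = eta(A x {i}) *)
Definition component (A : set 'rV[R]_n) : \bar R := eta (A `*` [set i]).

Let mcomp (A : set 'rV[R]_n) : measurable A -> measurable (A `*` [set i]).
Proof. by move=> mA; exact: measurableX. Qed.

Let component0 : component set0 = 0%E.
Proof. by rewrite /component set0X measure0. Qed.

Let component_ge0 A : (0 <= component A)%E.
Proof. exact: measure_ge0. Qed.

Let component_sigma_additive : semi_sigma_additive component.
Proof.
move=> G mG tG mUG; rewrite /component.
have -> : (\bigcup_k G k) `*` [set i] = \bigcup_k (G k `*` [set i]).
  by rewrite setX_bigcupl.
apply: measure_semi_sigma_additive.
- by move=> k; exact: mcomp.
- move=> j k _ _ [[x l] [[/= Gj _] [/= Gk _]]].
  by apply: tG => //; exists x.
- by apply: bigcup_measurable => k _; exact: mcomp.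
Qed.

HB.instance Definition _ := isMeasure.Build _ 'rV[R]_n R component
  component0 component_ge0 component_sigma_additive.

Let component_finite : fin_num_fun component.
Proof. by move=> A mA; apply: fin_num_measure; exact: mcomp. Qed.

HB.instance Definition _ := Measure_isFinite.Build _ 'rV[R]_n R component
  component_finite.

End regime_component.

(* gamma_i(A x B) = gamma((A x {i}) x B) *)
Definition coupling_component {R : realType} {n m : nat}
    (gamma : set (state R n m * 'rV[R]_n) -> \bar R) (i : 'I_m.+1)
    (C : set ('rV[R]_n * 'rV[R]_n)) : \bar R :=
  gamma [set z | z.1.2 = i /\ C (z.1.1, z.2)].

Section static_problem.
Context {R : realType} {n m : nat}.
Local Notation E := (state R n m).
Variables (P0T : probability (E * E)%type R)
          (rho : probability E R) (mup : probability 'rV[R]_n R).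
Local Open Scope ereal_scope.

Definition admissible (pi : probability (E * E)%type R) :=
  (forall A, measurable A -> pi [set z | A z.1] = rho A) /\
  (forall B, measurable B -> pi [set z | B z.2.1] = mup B).

Definition static_value : \bar R :=
  ereal_inf [set relative_entropy pi P0T | pi in admissible].

Definition optimal (pi : probability (E * E)%type R) :=
  admissible pi /\ relative_entropy pi P0T = static_value.

Definition nonneg_measurable (f : 'I_m.+1 -> 'rV[R]_n -> R)
    (g : 'rV[R]_n -> R) :=
  [/\ forall i, measurable_fun setT (f i), measurable_fun setT g,
      (forall i x, (0 <= f i x)%R) & (forall y, (0 <= g y)%R)].

(* d pi / d P_{0,T} (z_0, z_T) = f_{i_0}(x_0) g(x_T), pi-a.e. *)
Definition factorizes (pi : probability (E * E)%type R)
    (f : 'I_m.+1 -> 'rV[R]_n -> R) (g : 'rV[R]_n -> R) :=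
  {ae pi, forall z, RN_derivative pi P0T z
                    = (f z.1.2 z.1.1 * g z.2.1)%:E}.

Definition scaling_equivalent (f f' : 'I_m.+1 -> 'rV[R]_n -> R)
    (g g' : 'rV[R]_n -> R) :=
  exists2 c : R, (0 < c)%R &
    (forall i, {ae component rho i, forall x, f' i x = (c * f i x)%R}) /\
    {ae mup, forall y, g' y = (c^-1 * g y)%R}.

Definition schrodinger_system (pbar : 'I_m.+1 -> 'rV[R]_n -> 'rV[R]_n -> \bar R)
    (f : 'I_m.+1 -> 'rV[R]_n -> R) (g : 'rV[R]_n -> R) :=
  (forall i, {ae component rho i, forall x,
     1 = (f i x)%:E * \int[mup]_y (pbar i x y * (g y)%:E)}) /\
  {ae mup, forall y,
     1 = (g y)%:E *
         \sum_(i < m.+1) \int[component rho i]_x (pbar i x y * (f i x)%:E)}.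

(* (id_E x pr)_# pi, with pr (y, j) = y *)
Definition projected_coupling (pi : probability (E * E)%type R)
  : set (E * 'rV[R]_n) -> \bar R :=
  pushforward pi (fun z : E * E => (z.1, z.2.1)).

(* gamma_i(dx, dy) = f_i(x) pbar_i(x, y) g(y) rho_i(dx) mup(dy) *)
Definition coupling_formula (pbar : 'I_m.+1 -> 'rV[R]_n -> 'rV[R]_n -> \bar R)
    (pi : probability (E * E)%type R)
    (f : 'I_m.+1 -> 'rV[R]_n -> R) (g : 'rV[R]_n -> R) :=
  forall i (C : set ('rV[R]_n * 'rV[R]_n)), measurable C ->
    coupling_component (projected_coupling pi) i C
    = \int[component rho i \x mup]_(z in C)
        ((f i z.1)%:E * pbar i z.1 z.2 * (g z.2)%:E).

End static_problem.

(* Main.v *)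
Require Import Defs.
From HB Require Import structures.
From mathcomp Require Import all_boot all_order all_algebra.
From mathcomp Require Import all_classical all_reals all_analysis measurable_realfun.
From mathcomp Require Import ring lra.
Set Implicit Arguments.
Unset Strict Implicit.
Unset Printing Implicit Defensive.
Import Order.TTheory GRing.Theory Num.Theory.
Import numFieldNormedType.Exports.
Local Open Scope classical_set_scope.
Local Open Scope ring_scope.

(** Write nu for the product of rho and mup, P for the law of (Z_0, Z_T), Q for
    the law of (Z_0, X_T), and H for relative entropy.

    Forgetting the final regime never increases entropy ([data_processing]), and
    a coupling whose density with respect to P is a function k of (Z_0, X_T) has
    the entropy of its image k Q.  It is therefore enough to minimize H(k Q | Q)
    over the densities k of couplings of rho and mup, and to lift the minimizer
    to the density k(z_0, x_T) with respect to P.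

    A minimizer exists by an argument of Csiszar that uses no topology.  As
    H(k Q | Q) is the integral of phi(k) with phi(a) = a ln a - a + 1, a convexity
    estimate of Hellinger type ([dist_le_phi]) bounds the L1 distance of two
    competitors by how much their midpoint improves on them.  Minimizing
    sequences are thus Cauchy in L1; marginals pass to the limit, and Fatou's
    lemma gives optimality ([minimizer_exists]).  The same estimate gives
    uniqueness.

    Two perturbations describe the minimizer k.  Moving towards d nu / d Q, whose
    entropy is finite, has slope -oo at a point where k vanishes, so that k > 0
    nu-a.e. ([minimizer_gt0]).  Next, draw two independent points (x, y) and
    (x', y') from nu: exchanging y and y' preserves the law of the pair and both
    marginals.  The first variation of the entropy along such exchanges vanishes
    only if the product k(x, y) k(x', y') is unchanged by them, almost surely
    ([coupling_minimizer_cross_ratio]).  Freezing a suitable point (x', y') leaves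
    k(x, y) = f(x) g(y), nu-a.e. ([coupling_minimizer_factorizes]).

    It remains to compare null sets.  The complement of the support of nu is a
    countable union of nu-null rectangles, and a nu-null rectangle has a null
    side; so every coupling of rho and mup is carried by that support
    ([coupling_msupport]).  On it pbar and d nu / d Q are inverse to each other,
    whence k Q = k pbar nu ([coupling_density_product_measure]), a measure
    equivalent to nu.  All characterizations of (f, g) thus reduce to the single
    statement k = f g, nu-a.e.: the Schroedinger system says that f pbar g nu has
    marginals rho and mup, and if two pairs have the same product, freezing one
    variable shows that they differ by a constant factor. *)

(** * The entropy integrand *)

Section entropy_function.
Context {R : realType}.
Implicit Types a b e t : R.

(** Adding the term 1 - a, whose integral over a probability density is 0, makes
    the entropy integrand nonnegative: no integral below has the form oo - oo. *)
Definition phi a : R := a * ln a - a + 1.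

Lemma ln_le_sub1 a : 0 < a -> ln a <= a - 1.
Proof.
move=> a0; have := @le_ln1Dx R (a - 1).
by rewrite subrKC; apply; lra.
Qed.

(** The graph of phi lies above its tangent line at b, of slope ln b: multiply
    ln (b / a) <= b / a - 1 by a. *)
Lemma phi_tangent a b : 0 <= a -> 0 < b -> phi b + (a - b) * ln b <= phi a.
Proof.
move=> a0 b0; rewrite /phi; move: a0; rewrite le_eqVlt => /predU1P[<-|a0].
  by rewrite [ln 0]ln0//; nra.
have ba0 : 0 < b / a by exact: divr_gt0.
have h := ln_le_sub1 ba0.
have : a * ln (b / a) <= b - a.
  apply: le_trans (_ : a * (b / a - 1) <= _); first by rewrite ler_wpM2l// ltW.
  by rewrite mulrBr mulr1 mulrCA divff ?gt_eqF// mulr1.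
by rewrite ln_div// mulrBr; lra.
Qed.

Lemma phi_ge0 a : 0 <= a -> 0 <= phi a.
Proof.
move=> a0; have := phi_tangent a0 ltr01.
by rewrite {1}/phi ln1; lra.
Qed.

Lemma phi_convex t a b : 0 < t < 1 -> 0 <= a -> 0 <= b ->
  phi ((1 - t) * a + t * b) <= (1 - t) * phi a + t * phi b.
Proof.
move=> /andP[t0 t1] a0 b0; set c := _ + _.
have c0 : 0 <= c by rewrite /c addr_ge0// mulr_ge0//; lra.
move: c0; rewrite le_eqVlt => /predU1P[c0|c0].
  have /eqP := esym c0; rewrite /c paddr_eq0 ?mulr_ge0//; [|lra..].
  rewrite !mulf_eq0 (gt_eqF t0) gt_eqF ?subr_gt0//= => /andP[/eqP -> /eqP ->].
  by rewrite !mulr0 addr0; lra.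
have ha := phi_tangent a0 c0; have hb := phi_tangent b0 c0.
have := lerD (ler_wpM2l (_ : 0 <= 1 - t) ha) (ler_wpM2l (ltW t0) hb).
have -> : (1 - t) * (phi c + (a - c) * ln c) + t * (phi c + (b - c) * ln c)
  = phi c + ((1 - t) * a + t * b - c) * ln c by ring.
by rewrite subrr mul0r addr0; apply; lra.
Qed.

(** The last term, with its infinite slope in t at 0, is what forces minimizers
    of the entropy to be positive. *)
Lemma phi_scale t a : 0 < t -> 0 <= a ->
  phi (t * a) = (1 - t) * phi 0 + t * phi a + t * ln t * a.
Proof.
move=> t0; rewrite le_eqVlt => /predU1P[<-|a0].
  by rewrite mulr0; ring.
by rewrite /phi [ln 0]ln0// lnM// ; ring.
Qed.

(** Apply the tangent inequality to square roots: since ln a = 2 ln (sqrt a), the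
    first order bound turns into the quadratic bound
    a ln (a / s) - a + s >= (sqrt a - sqrt s)^2 at the midpoint s. *)
Lemma phi_hellinger a b : 0 <= a -> 0 <= b ->
  (Num.sqrt a - Num.sqrt b) ^+ 2 / 2 <=
    phi a + phi b - 2 * phi ((a + b) / 2).
Proof.
move=> a0 b0; set s := (a + b) / 2.
have s0 : 0 <= s by rewrite /s; lra.
move: s0; rewrite le_eqVlt => /predU1P[s0|s0].
  have a0' : a = 0 by rewrite /s in s0; lra.
  have b0' : b = 0 by rewrite /s in s0; lra.
  by rewrite -s0 a0' b0' subrr expr0n/= mul0r; lra.
have key x : 0 <= x ->
    (Num.sqrt x - Num.sqrt s) ^+ 2 <= x * (ln x - ln s) - x + s.
  move=> x0; set u := Num.sqrt x; set r := Num.sqrt s.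
  have r0 : 0 < r by rewrite sqrtr_gt0.
  have u0 : 0 <= u by exact: sqrtr_ge0.
  have -> : s = r ^+ 2 by rewrite sqr_sqrtr// ltW.
  have -> : x = u ^+ 2 by rewrite sqr_sqrtr.
  move: u0; rewrite le_eqVlt => /predU1P[<-|u0]; first by lra.
  rewrite !lnXn//; have := phi_tangent (ltW u0) r0; rewrite /phi => h.
  have := ler_wpM2l (ltW u0) h.
  rewrite !mulr2n; nra.
have sE : phi a + phi b - 2 * phi s =
  (a * (ln a - ln s) - a + s) + (b * (ln b - ln s) - b + s).
  have -> : 2 * phi s = (2 * s) * ln s - 2 * s + 2 by rewrite /phi; ring.
  have s2 : 2 * s = a + b by rewrite /s mulrC divfK.
  by rewrite /phi s2; clearbody s; nra.
rewrite sE; apply: le_trans (lerD (key _ a0) (key _ b0)).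
set x := Num.sqrt a; set y := Num.sqrt b; set z := Num.sqrt s.
have := sqr_ge0 (x + y - 2 * z); nra.
Qed.

(** Young's inequality with weight e, applied to the product
    |sqrt a - sqrt b| (sqrt a + sqrt b). *)
Lemma dist_le_phi a b e : 0 <= a -> 0 <= b -> 0 < e ->
  `|a - b| <= e^-1 * (phi a + phi b - 2 * phi ((a + b) / 2)) + e * (a + b).
Proof.
move=> a0 b0 e0; have := phi_hellinger a0 b0; set J := (phi a + _ - _).
set x := Num.sqrt a; set y := Num.sqrt b => h.
have x0 : 0 <= x by exact: sqrtr_ge0.
have y0 : 0 <= y by exact: sqrtr_ge0.
have aE : a = x ^+ 2 by rewrite sqr_sqrtr.
have bE : b = y ^+ 2 by rewrite sqr_sqrtr.
have hJ : e^-1 * ((x - y) ^+ 2 / 2) <= e^-1 * J.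
  by rewrite ler_wpM2l// invr_ge0 ltW.
apply: le_trans (_ : _ <= e^-1 * ((x - y) ^+ 2 / 2) + e * (a + b)) _; last first.
  by rewrite lerD2r.
have -> : `|a - b| = `|x - y| * (x + y).
  by rewrite aE bE subr_sqr normrM [`|x + y|]ger0_norm// addr_ge0.
rewrite aE bE; have <- : `|x - y| ^+ 2 = (x - y) ^+ 2 by rewrite real_normK ?num_real.
set d := `|x - y|.
rewrite -(ler_pM2l e0) [e * (_ + _)]mulrDr [e * (e^-1 * _)]mulVKf ?gt_eqF//.
have := sqr_ge0 (d - e * (x + y)); have := sqr_ge0 (x - y).
set w := e * (x + y); set v := e * (e * _).
have vE : w ^+ 2 + e ^+ 2 * (x - y) ^+ 2 = 2 * v by rewrite /w /v; ring.
have : 0 <= e ^+ 2 * (x - y) ^+ 2 by rewrite mulr_ge0// sqr_ge0.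
move=> k1 k2 k3.
have -> : e * (d * (x + y)) = d * w by rewrite /w; ring.
nra.
Qed.

(** A tangent line is a continuous minorant of phi.  For a > 0 take the one at a;
    at a = 0, where phi has none, take the one at the small point e / 2. *)
Lemma phi_lsc a e : 0 <= a -> 0 < e ->
  exists2 d, 0 < d & forall x, 0 <= x -> `|x - a| < d -> phi a - e <= phi x.
Proof.
move=> a0 e0.
have [b b0 hb] : exists2 b, 0 < b & phi a - e / 2 <= phi b + (a - b) * ln b.
  move: a0; rewrite le_eqVlt => /predU1P[<-|a0].
    by exists (e / 2); [lra|rewrite /phi [ln 0]ln0//; lra].
  by exists a => //; rewrite subrr; lra.
exists (e / 2 / (1 + `|ln b|)) => [|x x0 xa].
  by rewrite !divr_gt0 ?ltr_pwDl.
have := phi_tangent x0 b0.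
have : - (e / 2) <= (x - a) * ln b.
  rewrite lerNl; apply: le_trans (ler_norm _) _; rewrite normrN normrM.
  apply: le_trans (_ : `|x - a| * (1 + `|ln b|) <= _).
    by rewrite ler_wpM2l// lerDr.
  by rewrite -ler_pdivlMr ?ltr_pwDl// ltW.
by lra.
Qed.

Lemma measurable_phi : measurable_fun setT phi.
Proof.
apply: measurable_funD; last exact: measurable_cst.
apply: measurable_funB; last exact: measurable_id.
by apply: measurable_funM; [exact: measurable_id|exact: measurable_ln].
Qed.

End entropy_function.

(** * Densities and relative entropy *)

Lemma dominates_ae {R : realType} {d} {U : measurableType d}
    (nu mu : {measure set U -> \bar R}) (P : U -> Prop) :
  nu `<< mu -> {ae mu, forall x, P x} -> {ae nu, forall x, P x}.
Proof.
move=> /null_content_dominatesP dom [N [mN N0 PN]]; exists N; split => //.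
exact: dom.
Qed.

Section densities.
Context {R : realType} {d : measure_display} {U : measurableType d}.
Local Open Scope ereal_scope.

(** A real-valued variant of [is_density]: products of densities then never meet
    the convention 0 * oo. *)
Definition real_density (nu mu : set U -> \bar R) (k : U -> R) :=
  [/\ measurable_fun setT k, (forall x, (0 <= k x)%R) &
      forall A, measurable A -> nu A = \int[mu]_(x in A) (k x)%:E].

Lemma ge0_integral_eq0_ae (mu : {measure set U -> \bar R}) A (f : U -> \bar R) :
  measurable A -> measurable_fun A f -> (forall x, 0 <= f x) ->
  \int[mu]_(x in A) f x = 0 -> {ae mu, forall x, A x -> f x = 0}.
Proof.
move=> mA mf f0 If; apply/ae_eq_integral_abs => //.
by rewrite -[RHS]If; apply: eq_integral => x _; rewrite gee0_abs.
Qed.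

Lemma prob_integral_cst (mu : probability U R) (r : \bar R) :
  \int[mu]_x cst r x = r.
Proof.
by rewrite -[RHS]mule1 -(probability_setT mu) integral_cst.
Qed.

Lemma measurable_lne : measurable_fun setT (@lne R).
Proof.
have -> : @lne R = fun x => if x <= 0 then -oo
    else if x == +oo then +oo else (ln (fine x))%:E.
  apply/funext => -[r| |] //=; rewrite ?lee_fin ?leNye//.
apply: measurable_fun_ifT => //; first exact: measurable_fun_lee.
apply: measurable_fun_ifT => //; first exact: measurable_fun_eqe.
by apply/measurable_EFinP; exact: measurableT_comp.
Qed.

Section density_of_measure.
Variables (nu : {finite_measure set U -> \bar R})
  (mu : {finite_measure set U -> \bar R}) (k : U -> R).
Hypothesis hk : real_density nu mu k.

Let mk : measurable_fun setT (EFin \o k).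
Proof. by apply/measurable_EFinP; case: hk. Qed.

Lemma real_density_dominates : nu `<< mu.
Proof.
case: hk => _ _ nuE; apply/null_content_dominatesP => A mA A0.
by rewrite nuE// null_set_integral//; exact: measurable_funTS.
Qed.

(** A nu-null set is mu-null where the density of nu is positive. *)
Lemma real_density_ae (P : U -> Prop) :
  {ae nu, forall x, P x} -> {ae mu, forall x, (0 < k x)%R -> P x}.
Proof.
case: hk => _ k0 nuE [N [mN N0 PN]].
have := @ge0_integral_eq0_ae mu N _ mN (measurable_funTS mk).
rewrite -nuE// N0 => /(_ (fun x => _) erefl) => h.
have {h} := h (fun x => ltac:(rewrite lee_fin; exact: k0)).
apply: filterS => x /= kN kx; apply: contrapT => nP.
by have /kN [] := PN _ nP => /eqP; rewrite gt_eqF.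
Qed.

Lemma real_density_gt0_ae : {ae nu, forall x, (0 < k x)%R}.
Proof.
case: hk => mk' k0 nuE.
exists (k @^-1` [set 0%R]); split.
- by rewrite -[X in measurable X]setTI; exact: mk'.
- rewrite nuE; last by rewrite -[X in measurable X]setTI; exact: mk'.
  by apply: integral0_eq => x /= ->.
- move=> x /= kx; apply/eqP; rewrite eq_le k0 andbT leNgt.
  exact/negP.
Qed.

Lemma real_density_integrable : mu.-integrable setT (EFin \o k).
Proof.
case: hk => _ k0 nuE; apply/integrableP; split => //.
under eq_integral do rewrite /= ger0_norm//.
by rewrite -nuE//; exact: fin_num_fun_lty.
Qed.

Lemma real_density_integral (F : U -> \bar R) A : measurable A ->
  (forall x, 0 <= F x) -> measurable_fun A F ->
  \int[nu]_(x in A) F x = \int[mu]_(x in A) (F x * (k x)%:E).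
Proof.
move=> mA F0 mF; have dom := real_density_dominates.
rewrite -(Radon_Nikodym_SigmaFinite.change_of_variables dom F0 mA mF).
have fi := Radon_Nikodym_SigmaFinite.f_integrable dom.
have mf := measurable_int _ fi.
apply: ge0_ae_eq_integral => //.
- by apply: emeasurable_funM => //; exact: measurable_funTS.
- by apply: emeasurable_funM => //; exact: measurable_funTS.
- move=> x _; rewrite mule_ge0//.
  exact: Radon_Nikodym_SigmaFinite.f_ge0.
- by case: hk => _ k0 _ x _; rewrite mule_ge0// lee_fin.
apply: ae_eqe_mul2l.
apply: (ae_eq_subset (@subsetT _ A)).
apply: integral_ae_eq => // E _ mE.
rewrite -Radon_Nikodym_SigmaFinite.f_integral//.
by case: hk => _ _; exact.
Qed.

(** As k >= 0, the positive and negative parts of the two integrands correspond,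
    so the identity also covers functions that are not integrable. *)
Lemma real_density_integral_real (f : U -> R) : measurable_fun setT f ->
  \int[nu]_x (f x)%:E = \int[mu]_x (f x * k x)%:E.
Proof.
case: hk => _ k0 _ mf; have mfE : measurable_fun setT (EFin \o f).
  exact/measurable_EFinP.
rewrite integralE [RHS]integralE; congr (_ - _).
- rewrite real_density_integral//; last exact: measurable_funepos.
  apply: eq_integral => x _; rewrite !funeposE -!EFin_max -EFinM.
  by rewrite maxr_pMl// mul0r.
- rewrite real_density_integral//; last exact: measurable_funeneg.
  apply: eq_integral => x _; rewrite !funenegE -!EFinN -!EFin_max -EFinM.
  by rewrite maxr_pMl// mul0r mulNr.
Qed.

End density_of_measure.

Lemma exists_real_density (nu mu : {finite_measure set U -> \bar R}) :
  nu `<< mu -> exists k, real_density nu mu k.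
Proof.
move=> dom; pose f := Radon_Nikodym_SigmaFinite.f nu mu.
have f_fin := Radon_Nikodym_SigmaFinite.f_fin_num dom.
have f0 := Radon_Nikodym_SigmaFinite.f_ge0 dom.
have mf := measurable_int _ (Radon_Nikodym_SigmaFinite.f_integrable dom).
exists (fine \o f); split => [|x|A mA].
- exact: measurableT_comp.
- exact: fine_ge0.
- rewrite (Radon_Nikodym_SigmaFinite.f_integral dom)//.
  by apply: eq_integral => x _; rewrite /= fineK.
Qed.

Lemma RN_derivativeE (alpha beta : probability U R) k :
  real_density alpha beta k ->
  {ae beta, forall x, RN_derivative alpha beta x = (k x)%:E}.
Proof.
move=> hk; have dom := real_density_dominates hk.
have ik := real_density_integrable hk.
have : ae_eq beta setT (EFin \o k) (RN_derivative alpha beta).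
  apply: integral_ae_eq => //.
    exact: measurable_int (Radon_Nikodym_integrable _).
  move=> A _ mA; rewrite /RN_derivative -Radon_Nikodym_integral//.
  by case: hk => _ _ /(_ _ mA) <-.
by apply: filterS => x /= /(_ I).
Qed.

Lemma real_density_prob_integral (alpha beta : probability U R) k :
  real_density alpha beta k -> \int[beta]_x (k x)%:E = 1.
Proof. by case=> _ _ /(_ _ measurableT) <-; rewrite probability_setT. Qed.

(** Since - a ln a <= 1, the negative part of the logarithm has a finite integral
    against alpha, so the entropy is a well-defined difference. *)
Lemma entropy_split (alpha beta : probability U R) k :
  real_density alpha beta k ->
  let f x := (ln (k x))%:E in
  \int[alpha]_x f^\- x \is a fin_num /\
  \int[beta]_x (phi (k x))%:E + \int[alpha]_x f^\- x = \int[alpha]_x f^\+ x.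
Proof.
move=> hk f; have [mk k0 kE] := hk.
have mf : measurable_fun setT f.
  by apply/measurable_EFinP; exact: measurableT_comp.
have mfp : measurable_fun setT f^\+ by exact: measurable_funepos.
have mfn : measurable_fun setT f^\- by exact: measurable_funeneg.
rewrite (real_density_integral hk measurableT)//.
rewrite (real_density_integral hk measurableT)//.
have mkE : measurable_fun setT (EFin \o k) by exact/measurable_EFinP.
have mphi : measurable_fun setT (fun x => (phi (k x))%:E).
  by apply/measurable_EFinP; apply: measurableT_comp => //; exact: measurable_phi.
have mp : measurable_fun setT (fun x => f^\+ x * (k x)%:E).
  exact: emeasurable_funM.
have mn : measurable_fun setT (fun x => f^\- x * (k x)%:E).
  exact: emeasurable_funM.
have p0 x : 0 <= f^\+ x * (k x)%:E by rewrite mule_ge0// lee_fin.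
have n0 x : 0 <= f^\- x * (k x)%:E by rewrite mule_ge0// lee_fin.
have phi0 x : 0 <= (phi (k x))%:E by rewrite lee_fin phi_ge0.
have fp x : f^\+ x * (k x)%:E = (Num.max (ln (k x)) 0 * k x)%:E.
  by rewrite funeposE /f -EFin_max EFinM.
have fn x : f^\- x * (k x)%:E = (Num.max (- ln (k x)) 0 * k x)%:E.
  by rewrite funenegE /f -EFinN -EFin_max EFinM.
have n1 x : f^\- x * (k x)%:E <= 1.
  rewrite fn lee_fin; have := phi_ge0 (k0 x); have := k0 x.
  by rewrite /phi /Num.max; case: ifP => _; nra.
have In : \int[beta]_x (f^\- x * (k x)%:E) \is a fin_num.
  rewrite ge0_fin_numE ?integral_ge0//.
  apply: (@le_lt_trans _ _ (\int[beta]_x (cst 1 x))).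
    exact: ge0_le_integral.
  by rewrite prob_integral_cst ltry.
split=> //.
have ik : \int[beta]_x (k x)%:E = 1 by exact: real_density_prob_integral hk.
have : \int[beta]_x (phi (k x))%:E + \int[beta]_x (f^\- x * (k x)%:E) +
       \int[beta]_x (k x)%:E = \int[beta]_x (f^\+ x * (k x)%:E) + \int[beta]_x cst 1 x.
  rewrite -!ge0_integralD//.
  all: try by [move=> x _; rewrite adde_ge0|exact: emeasurable_funD
              |move=> x _; rewrite lee_fin].
  apply: eq_integral => x _; rewrite fp fn /= -!EFinD; congr _%:E.
  rewrite /phi /Num.max oppr_lt0.
  by case: ltgtP => [_|_|e]; [ring|ring|rewrite -e; ring].
by rewrite ik prob_integral_cst => /(congr1 (fun z => z - 1)); rewrite !addeK.
Qed.

Lemma relative_entropyE (alpha beta : probability U R) k :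
  real_density alpha beta k ->
  relative_entropy alpha beta = \int[beta]_x (phi (k x))%:E.
Proof.
move=> hk; have dom := real_density_dominates hk.
have [mk k0 kE] := hk.
rewrite /relative_entropy; case: asboolP => // _.
have mlnk : measurable_fun setT (fun x => ln (k x)) by exact: measurableT_comp.
have mR : measurable_fun setT (RN_derivative alpha beta).
  exact: measurable_int (Radon_Nikodym_integrable _).
transitivity (\int[alpha]_x (ln (k x))%:E).
  apply: ae_eq_integral => //.
  - by apply: measurableT_comp => //; exact: measurable_lne.
  - exact/measurable_EFinP.
  - have h : ae_eq alpha setT (RN_derivative alpha beta) (EFin \o k).
      apply: null_dominates_ae_eq measurableT dom _.
      by apply: filterS (RN_derivativeE hk) => x /= -> _.
    apply: filterS2 h (real_density_gt0_ae hk) => x /= /(_ I) -> kx _.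
    by rewrite lne_EFin.
by rewrite integralE; have [bfin <-] := entropy_split hk; rewrite addeK.
Qed.

Lemma relative_entropy_lty (alpha beta : probability U R) :
  relative_entropy alpha beta < +oo -> exists k, real_density alpha beta k.
Proof.
rewrite /relative_entropy; case: asboolP => // dom _.
exact: exists_real_density.
Qed.

End densities.

(** * Minimizing the entropy of a density *)

Section minimization.
Context {R : realType} {d : measure_display} {U : measurableType d}.
Variable mu : probability U R.
Local Open Scope ereal_scope.

Definition unit_mass (k : U -> R) :=
  [/\ measurable_fun setT k, (forall x, (0 <= k x)%R) &
      \int[mu]_x (k x)%:E = 1].

Definition midpoint (h k : U -> R) : U -> R := fun x => ((h x + k x) / 2)%R.

Definition entropy_of (k : U -> R) := \int[mu]_x (phi (k x))%:E.

Lemma measurable_phi_comp (k : U -> R) : measurable_fun setT k ->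
  measurable_fun setT (fun x => (phi (k x))%:E).
Proof.
by move=> mk; apply/measurable_EFinP; apply: measurableT_comp measurable_phi _.
Qed.

Lemma entropy_of_ge0 k : (forall x, (0 <= k x)%R) -> 0 <= entropy_of k.
Proof. by move=> k0; apply: integral_ge0 => x _; rewrite lee_fin phi_ge0. Qed.

(** Integrate [dist_le_phi]: if h and k are within delta of a lower bound v that
    also holds at their midpoint, the convexity defect is at most 2 delta. *)
Lemma dist_le_entropy (h k : U -> R) (v delta e : R) :
  unit_mass h -> unit_mass k -> (0 < e)%R ->
  v%:E <= entropy_of (midpoint h k) ->
  entropy_of h <= (v + delta)%:E -> entropy_of k <= (v + delta)%:E ->
  \int[mu]_x `|h x - k x|%:E <= (e^-1 * (2 * delta) + 2 * e)%:E.
Proof.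
move=> [mh h0 Ih] [mk k0 Ik] e0 vmid hle kle.
have ei0 : (0 <= e^-1)%R by rewrite invr_ge0 ltW.
have mmid : measurable_fun setT (midpoint h k).
  by apply: measurable_funM => //; exact: measurable_funD.
have mid0 x : (0 <= midpoint h k x)%R by rewrite divr_ge0// addr_ge0.
have mphh := measurable_phi_comp mh; have mphk := measurable_phi_comp mk.
have mphm := measurable_phi_comp mmid.
have mhE : measurable_fun setT (EFin \o h) by exact/measurable_EFinP.
have mkE : measurable_fun setT (EFin \o k) by exact/measurable_EFinP.
have mdist : measurable_fun setT (fun x => `|h x - k x|%:E).
  by apply/measurable_EFinP; apply: measurableT_comp => //; exact: measurable_funB.
have phi0 f x : (forall x, (0 <= f x)%R) -> 0 <= (phi (f x))%:E.
  by move=> f0; rewrite lee_fin phi_ge0.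
have le1 : \int[mu]_x (`|h x - k x|%:E + (e^-1 * 2)%:E * (phi (midpoint h k x))%:E)
  <= \int[mu]_x ((e^-1)%:E * ((phi (h x))%:E + (phi (k x))%:E)
                 + e%:E * ((h x)%:E + (k x)%:E)).
  apply: ge0_le_integral => //.
  - move=> x _; rewrite adde_ge0// mule_ge0 ?phi0// lee_fin.
    by rewrite mulr_ge0.
  - by apply: emeasurable_funD => //; exact: measurable_funeM.
  - by apply: emeasurable_funD; apply: measurable_funeM; exact: emeasurable_funD.
  - move=> x _; rewrite -!(EFinD, EFinM) lee_fin.
    have := dist_le_phi (h0 x) (k0 x) e0.
    by rewrite /midpoint; lra.
move: le1.
rewrite ge0_integralD//; last 2 first.
- by move=> x _; rewrite mule_ge0 ?phi0// lee_fin mulr_ge0.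
- exact: measurable_funeM.
rewrite ge0_integralZl_EFin//; [|by move=> x _; exact: phi0|by rewrite mulr_ge0].
rewrite ge0_integralD//; last 4 first.
- by move=> x _; rewrite mule_ge0 ?adde_ge0 ?phi0// lee_fin.
- by apply: measurable_funeM; exact: emeasurable_funD.
- by move=> x _; rewrite mule_ge0 ?adde_ge0 ?lee_fin// ltW.
- by apply: measurable_funeM; exact: emeasurable_funD.
rewrite ge0_integralZl_EFin//; last 2 first.
- by move=> x _; rewrite adde_ge0 ?phi0.
- exact: emeasurable_funD.
rewrite ge0_integralZl_EFin//; last 3 first.
- by move=> x _; rewrite adde_ge0 ?lee_fin.
- exact: emeasurable_funD.
- exact: ltW.
rewrite ge0_integralD//; [|by move=> x _; exact: phi0..].
rewrite ge0_integralD//; [|by move=> x _; rewrite lee_fin..].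
rewrite Ih Ik -!/(entropy_of _) => le1.
have fin f : (forall x, (0 <= f x)%R) -> entropy_of f <= (v + delta)%:E ->
    entropy_of f \is a fin_num.
  by move=> f0 fle; rewrite ge0_fin_numE ?entropy_of_ge0// (le_lt_trans fle) ?ltry.
have fh := fin _ h0 hle; have fk := fin _ k0 kle.
move: le1 hle kle vmid; rewrite -(fineK fh) -(fineK fk) !lee_fin.
set a := fine _; set b := fine _ => le1 hle kle vmid.
have le2 : \int[mu]_x `|h x - k x|%:E + (e^-1 * 2 * v)%:E <=
    (e^-1 * (a + b) + e * 2)%:E.
  apply: le_trans (_ : _ <= \int[mu]_x `|h x - k x|%:E +
     (e^-1 * 2)%:E * entropy_of (midpoint h k)) _.
    by rewrite leeD2l// EFinM lee_wpmul2l// lee_fin mulr_ge0.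
  by apply: le_trans le1 _; rewrite -!(EFinD, EFinM).
rewrite -leeBrDr// in le2; apply: le_trans le2 _.
rewrite -EFinB lee_fin.
have := ler_wpM2l ei0 (lerD hle kle); nra.
Qed.

(** The case delta = 0 of the previous estimate, as e tends to 0. *)
Lemma minimizer_unique (h k : U -> R) (v : R) :
  unit_mass h -> unit_mass k -> v%:E <= entropy_of (midpoint h k) ->
  entropy_of h <= v%:E -> entropy_of k <= v%:E ->
  {ae mu, forall x, h x = k x}.
Proof.
move=> uh uk vmid hv kv.
have : \int[mu]_x `|h x - k x|%:E = 0.
  apply/eqP; rewrite eq_le; apply/andP; split; last first.
    by apply: integral_ge0 => x _; rewrite lee_fin.
  apply/lee_addgt0Pr => e e0; rewrite add0e.
  have := @dist_le_entropy h k v 0 (e / 2) uh uk _ vmid.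
  rewrite addr0 => /(_ _ hv kv); rewrite divr_gt0// => /(_ erefl).
  by rewrite !mulr0 add0r mulrC divfK.
move/ge0_integral_eq0_ae => h0.
have {h0} := h0 measurableT _ (fun x => ltac:(by rewrite lee_fin)).
case: uh uk => [mh _ _] [mk _ _].
have mdist : measurable_fun setT (fun x => `|h x - k x|%:E).
  by apply/measurable_EFinP; apply: measurableT_comp => //; exact: measurable_funB.
move=> /(_ mdist); apply: filterS => x /(_ I) [] /eqP.
by rewrite normr_eq0 subr_eq0 => /eqP.
Qed.

End minimization.

Section density_measure.
Context {R : realType} {d : measure_display} {U : measurableType d}.
Local Open Scope ereal_scope.
Variables (mu : probability U R) (k : U -> R).
Hypothesis hk : unit_mass mu k.

Let density_measure (A : set U) : \bar R := \int[mu]_(x in A) (k x)%:E.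

Let density_measure0 : density_measure set0 = 0.
Proof. exact: integral_set0. Qed.

Let density_measure_ge0 A : 0 <= density_measure A.
Proof. by case: hk => _ k0 _; apply: integral_ge0 => x _; rewrite lee_fin. Qed.

Let density_measure_sigma_additive : semi_sigma_additive density_measure.
Proof.
case: hk => mk k0 _; apply: semi_sigma_additive_nng_induced.
  exact/measurable_EFinP.
by move=> x; rewrite lee_fin.
Qed.

HB.instance Definition _ := isMeasure.Build _ U R density_measure
  density_measure0 density_measure_ge0 density_measure_sigma_additive.

Let density_measure_setT : density_measure setT = 1.
Proof. by case: hk. Qed.

HB.instance Definition _ :=
  Measure_isProbability.Build _ U R density_measure density_measure_setT.

Lemma probability_of_density : exists nu : probability U R, real_density nu mu k.
Proof.
exists density_measure.
by case: hk => mk k0 _; split.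
Qed.

End density_measure.

Section completeness.
Context {R : realType}.
Local Open Scope ereal_scope.

(** Absolute convergence of the telescoping series. *)
Lemma summable_increments_cvgn (u : R^nat) :
  \sum_(n <oo) `|u n.+1 - u n|%:E < +oo -> cvgn u.
Proof.
set S := (X in X < _) => Slty.
have S0 : 0 <= S by apply: nneseries_ge0 => n _ _; rewrite lee_fin.
have Sfin : S \is a fin_num by rewrite ge0_fin_numE.
have cs : cvgn (series (telescope u)).
  apply: normed_cvg; apply: nondecreasing_is_cvgn.
    by apply: nondecreasing_series => n _; rewrite /=.
  exists (fine S) => _ [n _ <-]; rewrite -lee_fin fineK//.
  rewrite /series /= -sumEFin.
  by apply: (nneseries_lim_ge n) => k _ _; rewrite lee_fin.
rewrite telescopeK in cs.
have -> : u = (fun n => (u n - u 0%N) + u 0%N)%R.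
  by apply/funext => n; rewrite subrK.
by apply: is_cvgD => //; exact: is_cvg_cst.
Qed.

Lemma geometric_sum_le (c : R) : (0 <= c)%R ->
  \sum_(n <oo) (c / 2 ^+ n)%:E <= (2 * c)%:E.
Proof.
move=> c0; apply: lime_le.
  by apply: is_cvg_nneseries => n _ _; rewrite lee_fin divr_ge0// exprn_ge0.
apply: nearW => n; rewrite sumEFin lee_fin big_mkord.
have -> : (\sum_(i < n) c / 2 ^+ i = 2 * c - 2 * c / 2 ^+ n)%R.
  elim: n => [|n IH]; first by rewrite big_ord0 expr0 divr1 subrr.
  rewrite big_ord_recr/= IH exprS invfM.
  have : (2 ^+ n != 0 :> R)%R by rewrite expf_neq0.
  by move=> h; field.
by rewrite gerBl divr_ge0 ?mulr_ge0// exprn_ge0.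
Qed.

Context {d : measure_display} {U : measurableType d}.
Variable mu : probability U R.

(** The sum of the absolute increments is integrable.  It is therefore finite
    almost everywhere, where the sequence converges, and it provides a dominating
    function. *)
Lemma fast_cauchy_setwise_limit (k_ : nat -> U -> R) (c : R) :
  (forall n, unit_mass mu (k_ n)) -> (0 <= c)%R ->
  (forall n, \int[mu]_x `|k_ n.+1 x - k_ n x|%:E <= (c / 2 ^+ n)%:E) ->
  exists k : U -> R, [/\ measurable_fun setT k, (forall x, (0 <= k x)%R),
    {ae mu, forall x, k_ n x @[n --> \oo] --> k x} &
    forall A, measurable A ->
      \int[mu]_(x in A) (k_ n x)%:E @[n --> \oo] --> \int[mu]_(x in A) (k x)%:E].
Proof.
move=> uk c0 kc.
have mk n : measurable_fun setT (k_ n) by case: (uk n).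
have k0 n x : (0 <= k_ n x)%R by case: (uk n).
have mkE n : measurable_fun setT (fun x => (k_ n x)%:E) by exact/measurable_EFinP.
have md n : measurable_fun setT (fun x => `|k_ n.+1 x - k_ n x|%:E).
  by apply/measurable_EFinP; apply: measurableT_comp => //; exact: measurable_funB.
pose S x := \sum_(n <oo) `|k_ n.+1 x - k_ n x|%:E.
have S0 x : 0 <= S x by apply: nneseries_ge0 => n _ _; rewrite lee_fin.
have mS : measurable_fun setT S.
  by apply: ge0_emeasurable_sum => // n x _ _; rewrite lee_fin.
have IS : \int[mu]_x S x < +oo.
  rewrite integral_nneseries//.
  apply: (@le_lt_trans _ _ (\sum_(n <oo) (c / 2 ^+ n)%:E)).
    apply: lee_nneseries => n _ //.
    by rewrite integral_ge0// => x _; rewrite lee_fin.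
  by apply: le_lt_trans (geometric_sum_le c0) _; rewrite ltry.
pose G x := (k_ 0%N x)%:E + S x.
have iG : mu.-integrable setT G.
  apply: integrableD => //.
    apply/integrableP; split => //.
    under eq_integral do rewrite /= ger0_norm//.
    by case: (uk 0%N) => _ _ ->; rewrite ltry.
  apply/integrableP; split => //.
  by under eq_integral do rewrite gee0_abs//.
have kG n x : `|(k_ n x)%:E| <= G x.
  rewrite gee0_abs ?lee_fin//.
  apply: (@le_trans _ _ ((k_ 0%N x)%:E + \sum_(0 <= i < n) `|k_ i.+1 x - k_ i x|%:E)).
    rewrite sumEFin -EFinD lee_fin -lerBlDl.
    rewrite -(telescope_sumr (fun i => k_ i x))//.
    by apply: ler_sum => i _; exact: ler_norm.
  by rewrite leeD2l//; apply: nneseries_lim_ge => i _ _; rewrite lee_fin.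
(* The maximum with 0 matters only where the sequence diverges. *)
pose k x := Num.max 0%R (fine (limn_esup (fun n => (k_ n x)%:E))).
have mes : measurable_fun setT (fun x => limn_esup (fun n => (k_ n x)%:E)).
  exact: measurable_fun_limn_esup.
have cvgk : {ae mu, forall x, k_ n x @[n --> \oo] --> k x}.
  have : mu.-integrable setT S.
    by apply/integrableP; split => //; under eq_integral do rewrite gee0_abs//.
  move/integrable_ae => /(_ measurableT); apply: filterS => x /(_ I) Sfin.
  have cu : cvgn (fun n => k_ n x).
    by apply: summable_increments_cvgn; rewrite -[X in X < _]/(S x) -ge0_fin_numE.
  have cE : (k_ n x)%:E @[n --> \oo] --> (limn (fun n => k_ n x))%:E.
    by apply: cvg_EFin => //; exact: nearW.
  rewrite /k is_cvg_limn_esupE; last by apply/cvg_ex; eexists; exact: cE.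
  rewrite (cvg_lim _ cE)//= max_r//.
  by apply: limr_ge => //; exact: nearW.
have mkk : measurable_fun setT k.
  by apply: measurable_maxr => //; exact: measurableT_comp.
exists k; split => //.
- by move=> x; rewrite /k le_max lexx.
- move=> A mA.
  have mkA n : measurable_fun A (fun x => (k_ n x)%:E) by exact: measurable_funTS.
  have mA' : measurable_fun A (fun x => (k x)%:E).
    by apply: measurable_funTS; exact/measurable_EFinP.
  have cA : {ae mu, forall x, A x -> (k_ n x)%:E @[n --> \oo] --> (k x)%:E}.
    by apply: filterS cvgk => x h _; apply: cvg_EFin => //; exact: nearW.
  have iA : mu.-integrable A G by exact: integrableS iG.
  have leA : {ae mu, forall x n, A x -> `|(k_ n x)%:E| <= G x}.
    by apply: aeW => x n _; exact: kG.
  by have [_ _ +] := dominated_convergence mA mkA mA' cA iA leA.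
Qed.

End completeness.

Section attainment.
Context {R : realType} {d : measure_display} {U : measurableType d}.
Variable mu : probability U R.
Local Open Scope ereal_scope.

(** Lower semicontinuity of phi along a sequence; at 0 the derivative of phi is
    infinite, and one inequality is all that Fatou's lemma requires. *)
Lemma phi_limn_einf (u : R^nat) (a : R) : (forall n, (0 <= u n)%R) ->
  u n @[n --> \oo] --> a -> (phi a)%:E <= limn_einf (fun n => (phi (u n))%:E).
Proof.
move=> u0 ua; have a0 : (0 <= a)%R.
  by rewrite -(cvg_lim _ ua)//; apply: limr_ge; [exact: cvgP ua|exact: nearW].
rewrite limn_einf_lim; apply/lee_subgt0Pr => e e0.
have [del del0 hdel] := phi_lsc a0 e0.
have /cvgrPdist_lt/(_ _ del0)[N _ hN] := ua.
apply: (@le_trans _ _ (einfs (fun n => (phi (u n))%:E) N)).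
  apply: le_ereal_inf_tmp => _ [n /= Nn <-]; rewrite -EFinB lee_fin.
  by apply: hdel => //; rewrite distrC; exact: hN.
rewrite (cvg_lim _ (@cvg_einfs_sup _ _))//.
by apply: ereal_sup_ubound; exists N.
Qed.

(** Choose competitors k_n within 4^-n of the infimum.  By [dist_le_entropy] with
    e = 2^-n, consecutive ones are at L1 distance at most 4 / 2^n, hence they
    converge setwise, and Fatou's lemma bounds the entropy of the limit. *)
Lemma minimizer_exists (K : set (U -> R)) (h0 : U -> R) :
  (forall k, K k -> unit_mass mu k) ->
  (forall h k, K h -> K k -> K (midpoint h k)) ->
  (forall (k_ : nat -> U -> R) (k : U -> R), (forall n, K (k_ n)) ->
     measurable_fun setT k -> (forall x, (0 <= k x)%R) ->
     (forall A, measurable A ->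
       \int[mu]_(x in A) (k_ n x)%:E @[n --> \oo] --> \int[mu]_(x in A) (k x)%:E) ->
     K k) ->
  K h0 -> entropy_of mu h0 < +oo ->
  exists k, K k /\ forall h, K h -> entropy_of mu k <= entropy_of mu h.
Proof.
move=> Kmass Kmid Kclosed Kh0 h0lty.
have K0 k x : K k -> (0 <= k x)%R by move=> /Kmass[].
pose V := ereal_inf [set entropy_of mu k | k in K].
have V0 : 0 <= V.
  by apply: le_ereal_inf_tmp => _ [k Kk <-]; apply: entropy_of_ge0 => x; exact: K0.
have Vle k : K k -> V <= entropy_of mu k.
  by move=> Kk; apply: ereal_inf_lbound; exists k.
have Vfin : V \is a fin_num.
  by rewrite ge0_fin_numE//; apply: le_lt_trans h0lty; exact: Vle.
pose v := fine V.
have vE : V = v%:E by rewrite fineK.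
have /choice[k_ hk_] n : exists k, K k /\ entropy_of mu k <= (v + (4 ^+ n)^-1)%:E.
  have [|_ [k Kk <-] kV] := @lb_ereal_inf_adherent R _ ((4 ^+ n)^-1) _ Vfin.
    by rewrite invr_gt0 exprn_gt0.
  by exists k; split => //; rewrite EFinD -vE ltW.
have Kk n : K (k_ n) by case: (hk_ n).
have kV n : entropy_of mu (k_ n) <= (v + (4 ^+ n)^-1)%:E by case: (hk_ n).
have inc n : \int[mu]_x `|k_ n.+1 x - k_ n x|%:E <= (4 / 2 ^+ n)%:E.
  have vmid : v%:E <= entropy_of mu (midpoint (k_ n.+1) (k_ n)).
    by rewrite -vE; apply: Vle; exact: Kmid.
  have kS : entropy_of mu (k_ n.+1) <= (v + (4 ^+ n)^-1)%:E.
    apply: le_trans (kV n.+1) _; rewrite lee_fin lerD2l lef_pV2 ?posrE ?exprn_gt0//.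
    by rewrite ler_eXn2l// ltr1n.
  have e0 : (0 < (2 ^+ n)^-1 :> R)%R by rewrite invr_gt0 exprn_gt0.
  apply: le_trans (dist_le_entropy (Kmass _ (Kk n.+1)) (Kmass _ (Kk n)) e0
    vmid kS (kV n)) _.
  rewrite lee_fin invrK (_ : 4 ^+ n = 2 ^+ n * 2 ^+ n)%R; last first.
    by rewrite -exprMn; congr (_ ^+ _)%R; ring.
  have : (2 ^+ n != 0 :> R)%R by rewrite expf_neq0.
  by move=> h; rewrite le_eqVlt; apply/orP; left; apply/eqP; field.
have [k [mk k0 cvgk cvgA]] :=
  fast_cauchy_setwise_limit (fun n => Kmass _ (Kk n)) (ler0n _ 4) inc.
have KK : K k by exact: (Kclosed k_).
exists k; split => // h Kh; apply: le_trans (Vle _ Kh).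
rewrite /entropy_of.
have mphi n : measurable_fun setT (fun x => (phi (k_ n x))%:E).
  by apply: measurable_phi_comp; case: (Kmass _ (Kk n)).
have phi0 n x : 0 <= (phi (k_ n x))%:E by rewrite lee_fin phi_ge0// K0.
have -> : V = limn_einf (fun n => entropy_of mu (k_ n)).
  have c : entropy_of mu (k_ n) @[n --> \oo] --> V.
    apply: (@squeeze_cvge _ _ _ _ (cst V) _ (fun n => (v + (4 ^+ n)^-1)%:E)).
    - by apply: nearW => n; rewrite kV andbT /=; exact: Vle.
    - exact: cvg_cst.
    - rewrite vE; apply: cvg_EFin; first exact: nearW.
      rewrite -[X in _ --> X]addr0; apply: cvgD; first exact: cvg_cst.
      under eq_cvg do rewrite -exprVn.
      by apply: cvg_expr; rewrite ger0_norm ?invr_ge0// invf_lt1// ltr1n.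
  by rewrite is_cvg_limn_einfE ?(cvg_lim _ c)//; apply: cvgP c.
apply: le_trans (@fatou _ _ _ mu _ measurableT _ mphi (fun n x _ => phi0 n x)).
apply: ae_ge0_le_integral => //.
- by move=> x _; rewrite lee_fin phi_ge0.
- exact: measurable_phi_comp.
- move=> x _; rewrite limn_einf_lim; apply: lime_ge.
    exact: is_cvg_einfs.
  by apply: nearW => n; apply: le_ereal_inf_tmp => _ [m _ <-].
- rewrite /limn_einf; apply: measurableT_comp => //.
  by apply: measurable_fun_limn_esup => n; exact: measurableT_comp.
- by apply: filterS cvgk => x kx _; apply: phi_limn_einf => // n; exact: K0.
Qed.

End attainment.

(** * Entropy of image measures *)

Section data_processing.
Context {R : realType} {d d' : measure_display}.
Context {W : measurableType d} {U : measurableType d'}.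
Local Open Scope ereal_scope.

Lemma ge0_integral_image (P : probability W R) (Q : probability U R) (p : W -> U)
    (F : U -> \bar R) A : measurable_fun setT p ->
  (forall B, measurable B -> Q B = P (p @^-1` B)) ->
  measurable A -> measurable_fun A F -> (forall y, 0 <= F y) ->
  \int[Q]_(y in A) F y = \int[P]_(x in p @^-1` A) F (p x).
Proof.
move=> mp QE mA mF F0.
rewrite (eq_measure_integral (pushforward P p)); last by move=> B mB _; exact: QE.
by rewrite ge0_integral_pushforward// => y _.
Qed.

(** The tangent inequality at k (p x) gives phi h >= 1 - k (p x) + h ln (k (p x)).
    Integrated against P, the last term only sees the image of pi, and the right
    hand side becomes the entropy of gamma. *)
Lemma data_processing (P pi : probability W R) (Q gamma : probability U R)
    (p : W -> U) h k : measurable_fun setT p ->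
  (forall B, measurable B -> Q B = P (p @^-1` B)) ->
  (forall B, measurable B -> gamma B = pi (p @^-1` B)) ->
  real_density pi P h -> real_density gamma Q k ->
  entropy_of Q k <= entropy_of P h.
Proof.
move=> mp QE gE hh hk.
have [mh h0 hE] := hh; have [mk k0 kE] := hk.
pose f y := (ln (k y))%:E; have [bfin] := entropy_split hk; rewrite -/f.
rewrite -/(entropy_of Q k) -/f in bfin * => kab.
have mf : measurable_fun setT f.
  by apply/measurable_EFinP; exact: measurableT_comp.
have mfp : measurable_fun setT f^\+ by exact: measurable_funepos.
have mfn : measurable_fun setT f^\- by exact: measurable_funeneg.
have mhE : measurable_fun setT (fun x => (h x)%:E) by exact/measurable_EFinP.
have mkp : measurable_fun setT (fun x => (k (p x))%:E).
  by apply/measurable_EFinP; exact: measurableT_comp mk mp.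
have mfpp : measurable_fun setT (fun x => f^\+ (p x)).
  exact: (measurableT_comp mfp mp).
have mfnp : measurable_fun setT (fun x => f^\- (p x)).
  exact: (measurableT_comp mfn mp).
have mphi : measurable_fun setT (fun x => (phi (h x))%:E).
  exact: measurable_phi_comp.
have mp1 : measurable_fun setT (fun x => f^\+ (p x) * (h x)%:E).
  exact: emeasurable_funM.
have mn1 : measurable_fun setT (fun x => f^\- (p x) * (h x)%:E).
  exact: emeasurable_funM.
have transfer F : measurable_fun setT F -> (forall y, 0 <= F y) ->
    \int[gamma]_y F y = \int[P]_x (F (p x) * (h x)%:E).
  move=> mF F0; rewrite (ge0_integral_image mp gE)//.
  rewrite preimage_setT (real_density_integral hh measurableT)//.
  exact: (measurableT_comp mF mp).
have kpos : {ae P, forall x, k (p x) = 0%R -> h x = 0%R}.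
  have : {ae pi, forall x, (0 < k (p x))%R}.
    have [N [mN N0 kN]] := real_density_gt0_ae hk.
    exists (p @^-1` N); split; first by rewrite -[X in measurable X]setTI; exact: mp.
      by rewrite -gE.
    by move=> x /= kx; apply: kN.
  move/(real_density_ae hh); apply: filterS => x hx kx0.
  apply/eqP; rewrite eq_le h0 andbT leNgt; apply/negP => /hx.
  by rewrite kx0 ltxx.
rewrite -(leeD2rE _ _ bfin) kab.
rewrite !transfer//.
rewrite -(leeD2rE _ _ (erefl : (1 : \bar R) \is a fin_num)).
have mkE' : measurable_fun setT (fun y => (k y)%:E) by exact/measurable_EFinP.
have kE0' y : 0 <= (k y)%:E by rewrite lee_fin.
have Ik : \int[P]_x (k (p x))%:E = 1.
  rewrite -(real_density_prob_integral hk).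
  by rewrite (ge0_integral_image mp QE measurableT mkE' kE0') preimage_setT.
rewrite -[X in _ + X <= _](prob_integral_cst P 1) -[X in _ <= _ + X]Ik.
have phi0 x : 0 <= (phi (h x))%:E by rewrite lee_fin phi_ge0.
have hE0 x : 0 <= (h x)%:E by rewrite lee_fin.
have kE0 x : 0 <= (k (p x))%:E by rewrite lee_fin.
have p0 x : 0 <= f^\+ (p x) * (h x)%:E by rewrite mule_ge0.
have n0 x : 0 <= f^\- (p x) * (h x)%:E by rewrite mule_ge0.
rewrite /entropy_of -!ge0_integralD//.
all: try by [move=> x _; rewrite ?adde_ge0|exact: emeasurable_funD].
apply: ae_ge0_le_integral => //.
- by move=> x _; rewrite adde_ge0.
- exact: emeasurable_funD.
- by move=> x _; rewrite !adde_ge0.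
- by do 2 apply: emeasurable_funD => //.
apply: filterS kpos => x kx _.
rewrite funeposE funenegE /f -EFinN -!EFin_max -!(EFinM, EFinD) lee_fin.
have [k0x|k0x] := eqVneq (k (p x)) 0%R.
  rewrite k0x ln0// oppr0 maxxx kx// /phi ln0// !mul0r; lra.
have kx0 : (0 < k (p x))%R by rewrite lt_def k0x k0.
have := phi_tangent (h0 x) kx0; rewrite {1}/phi /Num.max oppr_lt0.
by case: ltrgtP => [_|_|e]; rewrite -?e; nra.
Qed.

End data_processing.

(** * Perturbing a minimizer *)

Section perturbations.
Context {R : realType} {d : measure_display} {U : measurableType d}.
Variable Q : probability U R.
Local Open Scope ereal_scope.

(** On the set where k vanishes, phi(t k0) contains the term t (ln t) k0.  By
    convexity elsewhere, the entropy of (1 - t) k + t k0 is at most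
    (1 - t) H(k) + t H(k0) + t (ln t) nu(k = 0), and minimality of k forces
    |ln t| nu(k = 0) <= H(k0) for every t. *)
Lemma minimizer_gt0 (nu : probability U R) (k k0 : U -> R) :
  unit_mass Q k -> real_density nu Q k0 -> entropy_of Q k0 < +oo ->
  entropy_of Q k <= entropy_of Q k0 ->
  (forall t, (0 < t < 1)%R ->
     entropy_of Q k <= entropy_of Q (fun x => ((1 - t) * k x + t * k0 x)%R)) ->
  {ae nu, forall x, (0 < k x)%R}.
Proof.
move=> [mk k_ge0 _] hk0 k0lty kk0 kmin; have [mk0 k0_ge0 k0E] := hk0.
pose N := k @^-1` [set 0%R].
have mN : measurable N by rewrite -[X in measurable X]setTI; exact: mk.
have nN_fin : nu N \is a fin_num by exact: fin_num_measure.
have e0_fin : entropy_of Q k0 \is a fin_num by rewrite ge0_fin_numE ?entropy_of_ge0.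
have v_fin : entropy_of Q k \is a fin_num.
  by rewrite ge0_fin_numE ?entropy_of_ge0// (le_lt_trans kk0).
have phi0 (f : U -> R) x : (forall x, (0 <= f x)%R) -> 0 <= (phi (f x))%:E.
  by move=> f0; rewrite lee_fin phi_ge0.
have key M : (0 < M)%R -> (M * fine (nu N) <= fine (entropy_of Q k0))%R.
  (* With this t, |ln t| = M is as large as one likes. *)
  move=> M0; pose t := expR (- M); have t0 : (0 < t)%R by exact: expR_gt0.
  have lnt : ln t = (- M)%R by exact: expRK.
  have t1 : (t < 1)%R by rewrite /t -[X in (_ < X)%R]expR0 ltr_expR oppr_lt0.
  have t01 : (0 < t < 1)%R by rewrite t0.
  pose kt x := ((1 - t) * k x + t * k0 x)%R.
  have kt0 x : (0 <= kt x)%R.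
    by rewrite addr_ge0// mulr_ge0// ?subr_ge0 ltW.
  have mkt : measurable_fun setT kt.
    by apply: measurable_funD; exact: measurable_funM.
  have mphit := measurable_phi_comp mkt; have mphi := measurable_phi_comp mk.
  have mphi0 := measurable_phi_comp mk0.
  have mind : measurable_fun setT (fun x => (k0 x * \1_N x)%:E).
    by apply/measurable_EFinP; apply: measurable_funM => //; exact: measurable_indic.
  have ind0 x : 0 <= (k0 x * \1_N x)%:E by rewrite lee_fin mulr_ge0.
  have tM : (0 <= t * M)%R by rewrite mulr_ge0// ltW.
  have t1' : (0 <= 1 - t)%R by rewrite subr_ge0 ltW.
  have le1 : \int[Q]_x ((phi (kt x))%:E + (t * M)%:E * (k0 x * \1_N x)%:E) <=
      \int[Q]_x ((1 - t)%:E * (phi (k x))%:E + t%:E * (phi (k0 x))%:E).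
    apply: ge0_le_integral => //.
    - by move=> x _; rewrite adde_ge0 ?phi0// mule_ge0.
    - by apply: emeasurable_funD => //; exact: measurable_funeM.
    - by apply: emeasurable_funD; exact: measurable_funeM.
    - move=> x _; rewrite -!(EFinM, EFinD) lee_fin indicE.
      have [/set_mem kx|_] := boolP (x \in N); last first.
        by rewrite !mulr0 addr0 phi_convex.
      by rewrite /kt kx mulr0 add0r phi_scale// lnt mulr1; lra.
  move: le1; rewrite ge0_integralD//; last 3 first.
  - by move=> x _; exact: phi0.
  - by move=> x _; rewrite mule_ge0.
  - exact: measurable_funeM.
  rewrite ge0_integralZl_EFin// ge0_integralD//; last 4 first.
  - by move=> x _; rewrite mule_ge0 ?phi0.
  - exact: measurable_funeM.
  - by move=> x _; rewrite mule_ge0 ?phi0// lee_fin ltW.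
  - exact: measurable_funeM.
  rewrite ge0_integralZl_EFin//; last by move=> x _; exact: phi0.
  rewrite ge0_integralZl_EFin//; [|by move=> x _; exact: phi0|exact: ltW].
  have -> : \int[Q]_x (k0 x * \1_N x)%:E = nu N.
    rewrite k0E// [RHS]integral_mkcond; apply: eq_integral => x _.
    rewrite patchE indicE; case: ifPn => xN; first by rewrite mulr1.
    by rewrite mulr0.
  rewrite -!/(entropy_of _ _) => le1.
  have {le1} : entropy_of Q k + (t * M)%:E * nu N <=
     (1 - t)%:E * entropy_of Q k + t%:E * entropy_of Q k0.
    by apply: le_trans le1; rewrite leeD2r//; exact: kmin.
  rewrite -(fineK v_fin) -(fineK e0_fin) -(fineK nN_fin) -!(EFinM, EFinD) lee_fin /=.
  have : (0 <= fine (entropy_of Q k))%R by rewrite fine_ge0// entropy_of_ge0.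
  set a := fine _; set b := fine (nu N); set c := fine _ => a0 h.
  by rewrite -(ler_pM2l t0); nra.
have nN0 : nu N = 0.
  rewrite -(fineK nN_fin); congr _%:E; apply/eqP; rewrite eq_le fine_ge0 ?andbT//.
  apply/ler_addgt0Pr => e e0; rewrite add0r.
  set b := fine (nu N); set c := fine (entropy_of Q k0) in key.
  have c0 : (0 <= c)%R by rewrite fine_ge0// entropy_of_ge0.
  have M0 : (0 < (c + 1) / e)%R by rewrite divr_gt0// ltr_wpDl.
  have := key _ M0; rewrite -/b mulrAC ler_pdivrMr// => h.
  have : ((c + 1) * b <= (c + 1) * e)%R by nra.
  by rewrite ler_pM2l// ltr_wpDl.
exists N; split => // x /= /negP; rewrite -leNgt => kx.
by apply/eqP; rewrite eq_le kx k_ge0.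
Qed.

(** The companion of [phi_tangent]: bound ln b by its own tangent at a. *)
Lemma phi_le_quadratic (a b : R) : (0 <= b)%R -> (0 < a)%R ->
  (phi b <= phi a + (b - a) * ln a + (b - a) ^+ 2 / a)%R.
Proof.
move=> b0 a0; have an0 : a != 0%R by rewrite gt_eqF.
move: b0; rewrite le_eqVlt => /predU1P[<-|b0].
  rewrite sub0r sqrrN expr2 mulfK// /phi mul0r; nra.
have : (b * (ln b - ln a) <= b * (b / a - 1))%R.
  apply: ler_wpM2l; first exact: ltW.
  by rewrite -ln_div ?posrE//; apply: ln_le_sub1; rewrite divr_gt0.
have -> : ((b - a) ^+ 2 / a = b * (b / a - 1) - (b - a))%R by field.
by rewrite /phi; nra.
Qed.

(** Integrate [phi_le_quadratic] along k - e h: the entropy changes by at most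
    - e times the integral of h ln k, plus O(e^2).  Divide by e and let e tend
    to 0. *)
Lemma first_variation (k h : U -> R) (C K : R) :
  unit_mass Q k -> entropy_of Q k < +oo -> measurable_fun setT h ->
  (0 < K)%R -> (0 < C)%R ->
  (forall x, (`|h x| <= C)%R) ->
  (forall x, h x != 0%R -> (K^-1 <= k x)%R /\ (`|ln (k x)| <= K)%R) ->
  (forall e, (0 < e)%R -> (forall x, (0 <= k x - e * h x)%R) ->
     entropy_of Q k <= entropy_of Q (fun x => (k x - e * h x)%R)) ->
  \int[Q]_x (h x * ln (k x))%:E <= 0.
Proof.
move=> [mk k0 _] klty mh K0 C0 hC hK kmin.
have v_fin : entropy_of Q k \is a fin_num by rewrite ge0_fin_numE ?entropy_of_ge0.
(* B bounds |g|: adding it makes the integrand nonnegative. *)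
pose g x := (h x * ln (k x))%R; pose B := (C * K)%R.
have B0 : (0 <= B)%R by rewrite mulr_ge0// ltW.
have mg : measurable_fun setT g.
  by apply: measurable_funM => //; exact: measurableT_comp.
have gB x : (`|g x| <= B)%R.
  rewrite /g normrM; have [->|hx] := eqVneq (h x) 0%R.
    by rewrite normr0 mul0r.
  by apply: ler_pM => //; have [] := hK _ hx.
have gB0 x : (0 <= g x + B)%R.
  by have := gB x; rewrite ler_norml => /andP[? _]; lra.
have mgB : measurable_fun setT (fun x => (g x + B)%:E).
  by apply/measurable_EFinP; exact: measurable_funD.
have mphi := measurable_phi_comp mk.
have bound e : (0 < e)%R -> (e <= (K * C)^-1)%R ->
    \int[Q]_x (g x + B)%:E <= (e * (C ^+ 2 * K) + B)%:E.
  move=> e0 eC.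
  have ke0 x : (0 <= k x - e * h x)%R.
    have [->|hx] := eqVneq (h x) 0%R; first by rewrite mulr0 subr0.
    have [Kk _] := hK _ hx; rewrite subr_ge0; apply: le_trans Kk.
    apply: le_trans (_ : _ <= (K * C)^-1 * C)%R _; last first.
      by rewrite invfM mulfVK// gt_eqF.
    apply: (@le_trans _ _ (e * C)%R); last by rewrite ler_wpM2r// ltW.
    apply: ler_wpM2l; first exact: ltW.
    exact: le_trans (ler_norm _) (hC _).
  pose b x := (k x - e * h x)%R.
  have mb : measurable_fun setT b.
    by apply: measurable_funB => //; exact: measurable_funM.
  have mphib := measurable_phi_comp mb.
  have phib0 x : 0 <= (phi (b x))%:E by rewrite lee_fin phi_ge0// ke0.
  have phik0 x : 0 <= (phi (k x))%:E by rewrite lee_fin phi_ge0.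
  have rest0 : (0 <= e ^+ 2 * (C ^+ 2 * K) + e * B)%R.
    by rewrite addr_ge0// !mulr_ge0// ?sqr_ge0// ltW.
  have le1 : \int[Q]_x ((phi (b x))%:E + e%:E * (g x + B)%:E) <=
      \int[Q]_x ((phi (k x))%:E + cst (e ^+ 2 * (C ^+ 2 * K) + e * B)%:E x).
    apply: ge0_le_integral => //.
    - by move=> x _; rewrite adde_ge0// mule_ge0// lee_fin// ltW.
    - by apply: emeasurable_funD => //; exact: measurable_funeM.
    - exact: emeasurable_funD.
    - move=> x _; rewrite /= -!(EFinM, EFinD) lee_fin /b /g.
      have [->|hx] := eqVneq (h x) 0%R.
        rewrite mulr0 subr0 mul0r add0r lerD2l lerDr.
        apply: mulr_ge0; first exact: sqr_ge0.
        by apply: mulr_ge0; [exact: sqr_ge0|exact: ltW].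
      have [Kk _] := hK _ hx; have kx0 : (0 < k x)%R.
        by apply: lt_le_trans Kk; rewrite invr_gt0.
      have := phi_le_quadratic (ke0 x) kx0.
      rewrite (_ : k x - e * h x - k x = - (e * h x))%R; last by ring.
      rewrite sqrrN exprMn => hq.
      have h1 : ((h x) ^+ 2 / k x <= C ^+ 2 * K)%R.
        apply: ler_pM; rewrite ?sqr_ge0 ?invr_ge0//.
          by rewrite -real_normK ?num_real// lerXn2r ?nnegrE// ltW.
        by rewrite -[leRHS]invrK lef_pV2 ?posrE ?invr_gt0.
      have : (e ^+ 2 * (h x ^+ 2 / k x) <= e ^+ 2 * (C ^+ 2 * K))%R.
        by rewrite ler_wpM2l// sqr_ge0.
      by rewrite mulrA; nra.
  move: le1; rewrite ge0_integralD//; last 2 first.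
  - by move=> x _; rewrite mule_ge0// lee_fin// ltW.
  - exact: measurable_funeM.
  rewrite ge0_integralZl_EFin//; [|by move=> x _; rewrite lee_fin|exact: ltW].
  rewrite ge0_integralD// prob_integral_cst -!/(entropy_of _ _) => le1.
  have {le1} : entropy_of Q k + e%:E * \int[Q]_x (g x + B)%:E <=
      entropy_of Q k + (e ^+ 2 * (C ^+ 2 * K) + e * B)%:E.
    by apply: le_trans le1; rewrite leeD2r//; exact: kmin.
  rewrite leeD2lE// => le1; rewrite -(@lee_pmul2l _ e%:E)// ?lte_fin//.
  by apply: le_trans le1 _; rewrite -EFinM lee_fin expr2; nra.
have le0 : \int[Q]_x (g x + B)%:E <= B%:E.
  apply/lee_addgt0Pr => e e0.
  pose M := (C ^+ 2 * K)%R; have M0 : (0 < M)%R by rewrite mulr_gt0// exprn_gt0.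
  pose s := Num.min (K * C)^-1%R (e / M)%R.
  have s0 : (0 < s)%R by rewrite lt_min invr_gt0 mulr_gt0// divr_gt0.
  have sK : (s <= (K * C)^-1)%R by rewrite ge_min lexx.
  apply: le_trans (bound _ s0 sK) _; rewrite -EFinD lee_fin addrC lerD2l.
  by rewrite -/M -ler_pdivlMr// ge_min lexx orbT.
have ig : Q.-integrable setT (EFin \o g).
  apply: measurable_bounded_integrable => //; first exact: fin_num_fun_lty.
  exists B; split; first exact: num_real.
  by move=> M BM x _; exact: le_trans (gB x) (ltW BM).
have iB : Q.-integrable setT (EFin \o cst B) by exact: finite_measure_integrable_cst.
move: le0; under eq_integral do rewrite EFinD.
rewrite (integralD_EFin measurableT ig iB) /=.
have -> : \int[Q]_x B%:E = B%:E by exact: prob_integral_cst.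
by rewrite -[X in _ <= X]add0e leeD2rE.
Qed.

End perturbations.

(** * Exchanging coordinates between two independent points *)

Section bounded_functions.
Context {R : realType} {d : measure_display} {U : measurableType d}.
Variable m : probability U R.
Local Open Scope ereal_scope.

Lemma bounded_integrable (f : U -> R) (M : R) :
  measurable_fun setT f -> (forall x, (`|f x| <= M)%R) ->
  m.-integrable setT (EFin \o f).
Proof.
move=> mf fM; apply: measurable_bounded_integrable => //.
  exact: fin_num_fun_lty.
exists M; split; first exact: num_real.
by move=> N MN x _; exact: le_trans (fM x) (ltW MN).
Qed.

Lemma invariant_integral (s : U -> U) (f : U -> R) (M : R) :
  measurable_fun setT s ->
  (forall C, measurable C -> m C = m (s @^-1` C)) ->
  measurable_fun setT f -> (forall x, (`|f x| <= M)%R) ->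
  \int[m]_x (f (s x))%:E = \int[m]_x (f x)%:E.
Proof.
move=> ms sE mf fM; have mfE : measurable_fun setT (EFin \o f).
  exact/measurable_EFinP.
transitivity (\int[pushforward m s]_x (f x)%:E).
  rewrite (integral_pushforward ms mfE) ?preimage_setT//.
  by apply: (@bounded_integrable _ M) => //; exact: measurableT_comp.
by apply: eq_measure_integral => A mA _; apply/esym; exact: sE.
Qed.

Lemma antiinvariant_integral (s : U -> U) (f : U -> R) (M : R) :
  measurable_fun setT s ->
  (forall C, measurable C -> m C = m (s @^-1` C)) ->
  measurable_fun setT f -> (forall x, (`|f x| <= M)%R) ->
  (forall x, f (s x) = - f x)%R -> \int[m]_x (f x)%:E = 0.
Proof.
move=> ms sE mf fM fs; have If := bounded_integrable mf fM.
have := invariant_integral ms sE mf fM.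
under eq_integral do rewrite fs EFinN.
have Ifin : \int[m]_x (f x)%:E \is a fin_num by exact: integrable_fin_num.
rewrite integralN; last exact: integrable_add_def.
by rewrite -(fineK Ifin) -EFinN => -[] h; congr _%:E; lra.
Qed.

End bounded_functions.

Section section_mean.
Context {R : realType} {d : measure_display} {U : measurableType d}.
Variable m : probability U R.
Local Open Scope ereal_scope.

(** The conditional mean of c given the first of two independent points. *)
Definition section_mean (c : U * U -> R) (z : U) : R :=
  fine (\int[m]_z' (c (z, z'))%:E).

Section bounded_kernel.
Variables (c : U * U -> R) (M : R).
Hypothesis mc : measurable_fun setT c.
Hypothesis cM : forall w, (`|c w| <= M)%R.

Let c_section z : measurable_fun setT (fun z' => c (z, z')).
Proof. by apply: measurableT_comp => //; exact: pair1_measurable. Qed.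

Let section_integrable z : m.-integrable setT (fun z' => (c (z, z'))%:E).
Proof. exact: bounded_integrable (c_section z) (fun z' => cM (z, z')). Qed.

Let section_meanE z : \int[m]_z' (c (z, z'))%:E = (section_mean c z)%:E.
Proof. by rewrite fineK//; exact: integrable_fin_num. Qed.

Lemma section_mean_bounded z : (`|section_mean c z| <= M)%R.
Proof.
rewrite -lee_fin -abse_EFin -section_meanE.
have mE : measurable_fun setT (fun z' => (c (z, z'))%:E) by exact/measurable_EFinP.
apply: le_trans (le_abse_integral _ measurableT mE) _.
apply: (@le_trans _ _ (\int[m]_z' (cst M%:E z'))).
  apply: ge0_le_integral => //; first exact: measurableT_comp.
  by move=> z' _; rewrite abse_EFin lee_fin.
by rewrite prob_integral_cst.
Qed.

Lemma section_mean_eq0 z : (forall z', c (z, z') = 0%R) -> section_mean c z = 0%R.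
Proof.
move=> c0; rewrite /section_mean.
by under eq_integral do rewrite c0; rewrite integral0.
Qed.

Let m2 : probability (U * U)%type R := (m \x m).

Lemma measurable_section_mean : measurable_fun setT (section_mean c).
Proof.
have ic : m2.-integrable setT (fun w => (c w)%:E) by exact: bounded_integrable mc cM.
by apply: measurableT_comp (measurable_fubini_F ic).
Qed.

Lemma section_mean_integral (g : U -> R) N : measurable_fun setT g ->
  (forall z, (`|g z| <= N)%R) ->
  \int[m]_z (section_mean c z * g z)%:E = \int[m \x m]_w (c w * g w.1)%:E.
Proof.
move=> mg gN.
have icg : m2.-integrable setT (fun w => (c w * g w.1)%:E).
  apply: (@bounded_integrable _ _ _ _ _ (M * N)%R) => [|w].
    by apply: measurable_funM => //; exact: measurableT_comp.
  by rewrite normrM ler_pM.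
rewrite -[RHS](integral12_prod_meas1 icg) /fubini_F.
apply: eq_integral => z _ /=; rewrite EFinM -section_meanE.
by rewrite -integralZr.
Qed.

End bounded_kernel.

End section_mean.

Section exchange.
Context {R : realType} {d d' : measure_display}.
Context {X : measurableType d} {Y : measurableType d'}.
Local Notation XY := (X * Y)%type.
Implicit Types w : XY * XY.

Definition exchange_snd w : XY * XY := ((w.1.1, w.2.2), (w.2.1, w.1.2)).
Definition exchange_fst w : XY * XY := ((w.2.1, w.1.2), (w.1.1, w.2.2)).
Definition exchange_pair w : XY * XY := (w.2, w.1).

Lemma measurable_exchange_snd : measurable_fun setT exchange_snd.
Proof.
apply: measurable_fun_pair; apply: measurable_fun_pair.
- by apply: measurableT_comp measurable_fst => //; exact: measurable_fst.
- by apply: measurableT_comp measurable_snd => //; exact: measurable_snd.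
- by apply: measurableT_comp measurable_snd => //; exact: measurable_fst.
- by apply: measurableT_comp measurable_fst => //; exact: measurable_snd.
Qed.

HB.instance Definition _ :=
  isMeasurableFun.Build _ _ _ _ exchange_snd measurable_exchange_snd.

Lemma measurable_exchange_pair : measurable_fun setT exchange_pair.
Proof. by apply: measurable_fun_pair. Qed.

HB.instance Definition _ :=
  isMeasurableFun.Build _ _ _ _ exchange_pair measurable_exchange_pair.

Lemma exchange_fstE w : exchange_fst w = exchange_pair (exchange_snd w).
Proof. by []. Qed.

Lemma measurable_exchange_fst : measurable_fun setT exchange_fst.
Proof.
exact: (measurableT_comp measurable_exchange_pair measurable_exchange_snd).
Qed.

Local Open Scope ereal_scope.
Variables (rho : probability X R) (mu : probability Y R).
Local Notation nu := (rho \x mu).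
Local Notation nu2 := (nu \x nu).

Lemma product_measure_commute (A : set XY) : measurable A ->
  nu A = \int[mu]_y rho (ysection A y).
Proof.
move=> mA; rewrite (@product_measure_unique _ _ _ _ _ rho mu (rho \x^ mu))//.
by move=> B C mB mC; exact: product_measure2E.
Qed.

(** It suffices to test products A x B.  The section at (x, y) of the preimage of
    A x B is the rectangle B^y x A_x, so that the double integral splits into
    nu A times nu B. *)
Lemma exchange_snd_invariant C : measurable C ->
  nu2 C = nu2 (exchange_snd @^-1` C).
Proof.
move=> mC.
suff H (A B : set XY) : measurable A -> measurable B ->
    distribution nu2 exchange_snd (A `*` B) = nu A * nu B.
  pose nuP : probability (X * Y)%type R := (rho \x mu).
  exact: (@product_measure_unique _ _ _ _ _ nuP nuP (distribution nu2 exchange_snd) H).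
move=> mA mB.
have mx z : measurable (xsection A z) by exact: measurable_xsection.
have my y : measurable (ysection B y) by exact: measurable_ysection.
have mF : measurable_fun setT
    (fun z : XY => rho (ysection B z.2) * mu (xsection A z.1)).
  apply: emeasurable_funM.
    by apply: measurableT_comp (measurable_fun_ysection _ mB) _; exact: measurable_snd.
  by apply: measurableT_comp (measurable_fun_xsection _ mA) _; exact: measurable_fst.
transitivity (\int[nu]_z (rho (ysection B z.2) * mu (xsection A z.1))).
  apply: eq_integral => -[x y] _ /=.
  rewrite -product_measure1E//; congr (nu _).
  by apply/seteqP; split => -[x' y'] /=; rewrite /xsection /ysection /= !inE => -[].
have mFx : measurable_fun setT (fun x => mu (xsection A x)).
  exact: measurable_fun_xsection.
have mFy : measurable_fun setT (fun y => rho (ysection B y)).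
  exact: measurable_fun_ysection.
rewrite (@fubini_tonelli1 _ _ _ _ _ rho mu _ mF); last by move=> z; rewrite mule_ge0.
rewrite /fubini_F /=.
under eq_integral => x _ do rewrite ge0_integralZr// -product_measure_commute//.
by rewrite ge0_integralZl// muleC.
Qed.

End exchange.

Section exchange_test.
Context {R : realType} {d d' : measure_display}.
Context {X : measurableType d} {Y : measurableType d'}.
Local Notation XY := (X * Y)%type.
Local Open Scope ereal_scope.
Variable nu : probability XY R.
Let nu2 : probability (XY * XY)%type R := (nu \x nu).
Hypothesis exchange_snd_inv : forall C, measurable C ->
  nu2 C = nu2 (@exchange_snd _ _ X Y @^-1` C).

Let exchange_pair_inv C : measurable C ->
  nu2 C = nu2 (@exchange_pair _ _ X Y @^-1` C).
Proof.
move=> mC.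
have H (A B : set XY) : measurable A -> measurable B ->
    distribution nu2 exchange_pair (A `*` B) = nu A * nu B.
  move=> mA mB; rewrite muleC -product_measure1E//.
  by congr (nu2 _); apply/seteqP; split => -[a b] [/= ? ?]; split.
exact: (product_measure_unique H).
Qed.

Let exchange_fst_inv C : measurable C ->
  nu2 C = nu2 (@exchange_fst _ _ X Y @^-1` C).
Proof.
move=> mC; rewrite exchange_pair_inv// exchange_snd_inv//.
by rewrite -[X in measurable X]setTI; exact: measurable_exchange_pair.
Qed.

Definition quad (S : set XY) : set (XY * XY) := [set w | [/\ S w.1, S w.2,
  S (exchange_snd w).1 & S (exchange_snd w).2]].

Lemma measurable_quad S : measurable S -> measurable (quad S).
Proof.
move=> mS; pose e := @exchange_snd _ _ X Y.
have mI (f : XY * XY -> XY) : measurable_fun setT f -> measurable (f @^-1` S).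
  by move=> mf; rewrite -[X in measurable X]setTI; exact: mf.
have -> : quad S = fst @^-1` S `&` snd @^-1` S `&`
    ((fst \o e) @^-1` S `&` (snd \o e) @^-1` S).
  by apply/seteqP; split => w /=; [case|case=> -[? ?] []].
have me : measurable_fun setT e by exact: measurable_exchange_snd.
by do 2 (apply: measurableI); apply: mI => //; apply: measurableT_comp.
Qed.

(** The test function of the exchange argument.  The indicator of [quad S] is
    invariant under all exchanges and makes l bounded at the four points. *)
Definition cross_difference (S : set XY) (l : XY -> R) w : R :=
  ((l w.1 + l w.2 - l (exchange_snd w).1 - l (exchange_snd w).2)
   * \1_(quad S) w)%R.

Section cross_difference.
Variables (S : set XY) (l : XY -> R) (L : R).
Hypotheses (mS : measurable S) (ml : measurable_fun setT l).
Hypothesis lL : forall z, S z -> (`|l z| <= L)%R.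
Local Notation c := (cross_difference S l).
Local Notation e := (@exchange_snd _ _ X Y).
Local Notation G := (quad S).

Lemma measurable_cross_difference : measurable_fun setT c.
Proof.
have mG := measurable_quad mS.
have me : measurable_fun setT e by exact: measurable_exchange_snd.
apply: measurable_funM; last exact: measurable_indic.
have ml' (f : XY * XY -> XY) : measurable_fun setT f -> measurable_fun setT (l \o f).
  by move=> mf; exact: measurableT_comp.
apply: measurable_funB; last by apply: (ml' (snd \o e)); exact: measurableT_comp.
apply: measurable_funB; last by apply: (ml' (fst \o e)); exact: measurableT_comp.
by apply: measurable_funD; [exact: (ml' fst)|exact: (ml' snd)].
Qed.

Let eK w : e (e w) = w. Proof. by case: w => -[? ?] []. Qed.

Let Gindic (s : XY * XY -> XY * XY) : (forall w, G w -> G (s w)) ->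
  (forall w, s (s w) = w) -> forall w, \1_G (s w) = \1_G w :> R.
Proof.
move=> Gs sK w; rewrite !indicE; congr (_ : bool)%:R; apply/idP/idP.
  by rewrite !inE => /Gs; rewrite sK.
by rewrite !inE; exact: Gs.
Qed.

Lemma cross_difference_snd w : c (e w) = (- c w)%R.
Proof.
rewrite /cross_difference eK Gindic//; first by ring.
by move=> {}w [? ? ? ?]; split => //; rewrite eK.
Qed.

Lemma cross_difference_pair w : c (exchange_pair w) = c w.
Proof.
rewrite /cross_difference Gindic; [|by move=> {}w []; split|by case].
have -> : e (exchange_pair w) = exchange_pair (e w) by [].
by rewrite /=; ring.
Qed.

Lemma cross_difference_fst w : c (exchange_fst w) = (- c w)%R.
Proof. by rewrite exchange_fstE cross_difference_pair cross_difference_snd. Qed.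

Lemma cross_difference_bounded w : (`|c w| <= 4 * `|L|)%R.
Proof.
rewrite /cross_difference indicE.
have [/set_mem[h1 h2 h3 h4]|_] := boolP (w \in G); last first.
  by rewrite mulr0 normr0 mulr_ge0.
rewrite mulr1; have lL' z : S z -> (`|l z| <= `|L|)%R.
  by move=> /lL h; exact: le_trans h (ler_norm _).
have := lL' _ h1; have := lL' _ h2; have := lL' _ h3; have := lL' _ h4.
rewrite !ler_norml => /andP[? ?] /andP[? ?] /andP[? ?] /andP[? ?].
by apply/andP; split; lra.
Qed.

Let lS z : R := (l z * \1_S z)%R.

Let mlS : measurable_fun setT lS.
Proof. by apply: measurable_funM => //; exact: measurable_indic. Qed.

Let lSL z : (`|lS z| <= `|L|)%R.
Proof.
rewrite /lS indicE; have [/set_mem Sz|_] := boolP (z \in S).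
  by rewrite mulr1 (le_trans (lL Sz))// ler_norm.
by rewrite mulr0 normr0.
Qed.

Let h w : R := (c w * lS w.1)%R.

Let sqr_cross_differenceE w : (c w ^+ 2 =
  h w + h (exchange_pair w) + (h (e w) + h (exchange_fst w)))%R.
Proof.
rewrite /h cross_difference_pair cross_difference_snd cross_difference_fst.
rewrite /cross_difference indicE.
have [/set_mem[h1 h2 h3 h4]|_] := boolP (w \in G); last by rewrite !mulr0; ring.
by rewrite /lS /= !indicE !mem_set//=; ring.
Qed.

(** Take for t the conditional mean of the cross difference c.  Exchanging second
    (resp. first) coordinates changes the sign of c, which makes both marginals
    of t vanish.  The four images of c(w) l(w.1) under the group generated by
    these exchanges add up to c^2, so that the integral of c^2 is four times the
    integral of t l, which is <= 0 by hypothesis. *)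
Lemma cross_difference_zero :
  (forall t : XY -> R, measurable_fun setT t ->
    (exists M : R, forall z, (`|t z| <= M)%R) -> (forall z, ~ S z -> t z = 0%R) ->
    (forall A, measurable A -> \int[nu]_z (t z * \1_A z.1)%:E = 0) ->
    (forall B, measurable B -> \int[nu]_z (t z * \1_B z.2)%:E = 0) ->
    \int[nu]_z (t z * l z)%:E <= 0) ->
  {ae nu2, forall w, quad S w ->
    (l w.1 + l w.2 = l (exchange_snd w).1 + l (exchange_snd w).2)%R}.
Proof.
move=> test; pose M : R := (4 * `|L|)%R.
have mc := measurable_cross_difference; have cM := cross_difference_bounded.
have me : measurable_fun setT e by exact: measurable_exchange_snd.
have mfst := @measurable_exchange_fst _ _ X Y.
have mpair := @measurable_exchange_pair _ _ X Y.
pose t := section_mean nu c.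
have mt : measurable_fun setT t.
  exact: (@measurable_section_mean R _ (X * Y)%type nu c _ mc cM).
have tM z : (`|t z| <= M)%R.
  exact: (@section_mean_bounded R _ (X * Y)%type nu c _ mc cM z).
have t0 z : ~ S z -> t z = 0%R.
  move=> nS; apply: section_mean_eq0 => z'.
  by rewrite /cross_difference indicE memNset ?mulr0// => -[].
have tfub := @section_mean_integral R _ (X * Y)%type nu c _ mc cM.
have mD (D : set X) : measurable D -> measurable_fun setT (fun z : XY => \1_D z.1 : R).
  by move=> ?; apply: measurableT_comp => //; exact: measurable_indic.
have mD' (D : set Y) : measurable D -> measurable_fun setT (fun z : XY => \1_D z.2 : R).
  by move=> ?; apply: measurableT_comp => //; exact: measurable_indic.
have ind1 (T : Type) (D : set T) z : (`|\1_D z| <= 1 :> R)%R.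
  by rewrite indicE; case: (_ \in _); rewrite ?normr1 ?normr0.
have tle0 : \int[nu]_z (t z * lS z)%:E <= 0.
  have -> : \int[nu]_z (t z * lS z)%:E = \int[nu]_z (t z * l z)%:E.
    apply: eq_integral => z _; rewrite /lS indicE.
    have [_|nS] := boolP (z \in S); first by rewrite mulr1.
    by rewrite t0 ?mul0r//; move: nS; rewrite notin_setE.
  apply: test => //; first by exists M.
  - move=> A mA; rewrite (tfub _ 1%R (mD _ mA) (fun z => ind1 _ _ _)).
    apply: (antiinvariant_integral me exchange_snd_inv (M := (M * 1)%R)).
    + by apply: measurable_funM => //; apply: measurableT_comp (mD _ mA) _.
    + by move=> w; rewrite normrM ler_pM.
    + by move=> w; rewrite cross_difference_snd mulNr.
  - move=> B mB; rewrite (tfub _ 1%R (mD' _ mB) (fun z => ind1 _ _ _)).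
    apply: (antiinvariant_integral mfst exchange_fst_inv (M := (M * 1)%R)).
    + by apply: measurable_funM => //; apply: measurableT_comp (mD' _ mB) _.
    + by move=> w; rewrite normrM ler_pM.
    + by move=> w; rewrite cross_difference_fst mulNr.
have mh : measurable_fun setT h.
  by apply: measurable_funM => //; apply: measurableT_comp mlS _.
have hN w : (`|h w| <= M * `|L|)%R by rewrite normrM ler_pM.
have Ih (s : XY * XY -> XY * XY) : measurable_fun setT s ->
    nu2.-integrable setT (EFin \o (h \o s)).
  move=> ms; apply: (@bounded_integrable _ _ _ _ _ (M * `|L|)%R).
    exact: measurableT_comp.
  by move=> w; exact: hN.
have Ic2 : \int[nu2]_w (c w ^+ 2)%:E <= 0.
  have -> : \int[nu2]_w (c w ^+ 2)%:E =
    \int[nu2]_w (((EFin \o (h \o id)) \+ (EFin \o (h \o exchange_pair))) w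
      + ((EFin \o (h \o e)) \+ (EFin \o (h \o exchange_fst))) w).
    by apply: eq_integral => w _; rewrite sqr_cross_differenceE !EFinD.
  rewrite integralD//; [|by apply: integrableD => //; exact: Ih..].
  rewrite !integralD//; [|by exact: Ih..].
  rewrite (invariant_integral mpair exchange_pair_inv mh hN).
  rewrite (invariant_integral me exchange_snd_inv mh hN).
  rewrite (invariant_integral mfst exchange_fst_inv mh hN).
  have Ih0 : \int[nu2]_w (h w)%:E <= 0 by rewrite -(tfub _ _ mlS lSL).
  by apply: adde_le0; apply: adde_le0; exact: Ih0.
have mc2 : measurable_fun setT (fun w => (c w ^+ 2)%:E).
  by apply/measurable_EFinP; exact: measurable_funX.
have c20 w : 0 <= (c w ^+ 2)%:E by rewrite lee_fin sqr_ge0.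
have Ic20 : \int[nu2]_w (c w ^+ 2)%:E = 0.
  by apply/eqP; rewrite eq_le Ic2 /=; exact: integral_ge0.
have := ge0_integral_eq0_ae measurableT mc2 c20 Ic20.
apply: filterS => w /(_ I) [] /eqP; rewrite sqrf_eq0 => /eqP + Gw.
by rewrite /cross_difference indicE mem_set// mulr1; lra.
Qed.

End cross_difference.

End exchange_test.

(** * Couplings of minimal entropy *)

Section almost_everywhere_product.
Context {R : realType} {d d' : measure_display}.
Context {X : measurableType d} {Y : measurableType d'}.
Local Open Scope ereal_scope.

Lemma ae_exists (m : probability X R) (P : X -> Prop) :
  {ae m, forall x, P x} -> exists x, P x.
Proof.
move=> [N [mN N0 PN]]; apply: contrapT => nP.
have NT : N = setT.
  by apply/seteqP; split => // x _; apply: PN => /= Px; apply: nP; exists x.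
by move: N0; rewrite NT probability_setT => /eqP; rewrite onee_eq0.
Qed.

Variables (rho : probability X R) (mu : probability Y R).
Local Notation nu := (rho \x mu).

Lemma ae_fst (P : X -> Prop) : {ae rho, forall x, P x} -> {ae nu, forall z, P z.1}.
Proof.
move=> [N [mN N0 PN]]; exists (N `*` setT); split; first exact: measurableX.
  have N0' : rho N = 0 := N0.
  transitivity (rho N * mu setT); first exact: product_measure1E.
  by rewrite N0' mul0e.
by move=> z /= Pz; split => //; exact: PN.
Qed.

Lemma ae_snd (P : Y -> Prop) : {ae mu, forall y, P y} -> {ae nu, forall z, P z.2}.
Proof.
move=> [N [mN N0 PN]]; exists (setT `*` N); split; first exact: measurableX.
  have N0' : mu N = 0 := N0.
  transitivity (rho setT * mu N); first exact: product_measure1E.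
  by rewrite N0' mule0.
by move=> z /= Pz; split => //; exact: PN.
Qed.

Lemma ae_xsection (P : X * Y -> Prop) : {ae nu, forall z, P z} ->
  {ae rho, forall x, {ae mu, forall y, P (x, y)}}.
Proof.
move=> [N [mN N0 PN]].
have mx : measurable_fun setT (fun x => mu (xsection N x)).
  exact: measurable_fun_xsection.
have := ge0_integral_eq0_ae measurableT mx (fun x => measure_ge0 mu _) N0.
apply: filterS => x /(_ I) Nx0; exists (xsection N x); split => //.
  exact: measurable_xsection.
by move=> y /= Py; rewrite /xsection/= inE; exact: PN.
Qed.

Lemma ae_ysection (P : X * Y -> Prop) : {ae nu, forall z, P z} ->
  {ae mu, forall y, {ae rho, forall x, P (x, y)}}.
Proof.
move=> [N [mN N0 PN]].
have my : measurable_fun setT (fun y => rho (ysection N y)).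
  exact: measurable_fun_ysection.
rewrite product_measure_commute// in N0.
have := ge0_integral_eq0_ae measurableT my (fun y => measure_ge0 rho _) N0.
apply: filterS => y /(_ I) Ny0; exists (ysection N y); split => //.
  exact: measurable_ysection.
by move=> x /= Px; rewrite /ysection/= inE; exact: PN.
Qed.

End almost_everywhere_product.

Section schrodinger_factorization.
Context {R : realType} {d d' : measure_display}.
Context {X : measurableType d} {Y : measurableType d'}.
Local Notation XY := (X * Y)%type.
Local Open Scope ereal_scope.
Variables (rho : probability X R) (mu : probability Y R).
Variable Q : probability XY R.
Let nu : probability XY R := (rho \x mu).
Let nu2 : probability (XY * XY)%type R := (nu \x nu).

Definition coupling_density (k : XY -> R) :=
  [/\ measurable_fun setT k, (forall z, (0 <= k z)%R),
      forall A, measurable A -> \int[Q]_(z in A `*` setT) (k z)%:E = rho A &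
      forall B, measurable B -> \int[Q]_(z in setT `*` B) (k z)%:E = mu B].

Lemma coupling_density_unit_mass k : coupling_density k -> unit_mass Q k.
Proof.
move=> [mk k0 kA _]; split => //.
by have := kA _ measurableT; rewrite setXTT probability_setT.
Qed.

Lemma coupling_density_integrable k : coupling_density k ->
  Q.-integrable setT (EFin \o k).
Proof.
move=> /coupling_density_unit_mass[mk k0 Ik].
apply/integrableP; split; first exact/measurable_EFinP.
by under eq_integral do rewrite /= ger0_norm//; rewrite Ik ltry.
Qed.

Lemma coupling_density_convex (t : R) h k : (0 < t < 1)%R ->
  coupling_density h -> coupling_density k ->
  coupling_density (fun z => ((1 - t) * h z + t * k z)%R).
Proof.
move=> /andP[t0 t1] hh hk.
have t1' : (0 <= 1 - t)%R by rewrite subr_ge0 ltW.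
have [mh h0 hA hB] := hh; have [mk k0 kA kB] := hk.
have lin D (r : R) : measurable D -> \int[Q]_(z in D) (h z)%:E = r%:E ->
    \int[Q]_(z in D) (k z)%:E = r%:E ->
    \int[Q]_(z in D) ((1 - t) * h z + t * k z)%:E = r%:E.
  move=> mD hr kr.
  have mhD : measurable_fun D (fun z => (h z)%:E).
    by apply: measurable_funTS; exact/measurable_EFinP.
  have mkD : measurable_fun D (fun z => (k z)%:E).
    by apply: measurable_funTS; exact/measurable_EFinP.
  under eq_integral do rewrite EFinD !EFinM.
  rewrite ge0_integralD//; last 4 first.
  - by move=> z _; rewrite mule_ge0// lee_fin.
  - exact: measurable_funeM.
  - by move=> z _; rewrite mule_ge0// lee_fin// ltW.
  - exact: measurable_funeM.
  rewrite ge0_integralZl_EFin//; last by move=> z _; rewrite lee_fin.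
  rewrite ge0_integralZl_EFin//; [|by move=> z _; rewrite lee_fin|exact: ltW].
  by rewrite hr kr -!EFinM -EFinD; congr _%:E; ring.
split.
- by apply: measurable_funD; exact: measurable_funM.
- by move=> z; rewrite addr_ge0// mulr_ge0// ltW.
- move=> A mA; have f : rho A \is a fin_num by exact: fin_num_measure.
  rewrite -(fineK f); apply: lin; first exact: measurableX.
    by rewrite fineK// hA.
  by rewrite fineK// kA.
- move=> B mB; have f : mu B \is a fin_num by exact: fin_num_measure.
  rewrite -(fineK f); apply: lin; first exact: measurableX.
    by rewrite fineK// hB.
  by rewrite fineK// kB.
Qed.

Lemma coupling_density_limit (k_ : nat -> XY -> R) (k : XY -> R) :
  (forall n, coupling_density (k_ n)) ->
  measurable_fun setT k -> (forall x, (0 <= k x)%R) ->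
  (forall A, measurable A ->
    \int[Q]_(x in A) (k_ n x)%:E @[n --> \oo] --> \int[Q]_(x in A) (k x)%:E) ->
  coupling_density k.
Proof.
move=> hk_ mk k0 lim.
have key D r : measurable D -> (forall n, \int[Q]_(x in D) (k_ n x)%:E = r) ->
    \int[Q]_(x in D) (k x)%:E = r.
  move=> mD kr; rewrite -(cvg_lim _ (lim D mD))//.
  by apply: lim_near_cst => //; exact: nearW.
split => // [A mA|B mB]; apply: key; try exact: measurableX.
  by move=> n; have [_ _ ->] := hk_ n.
by move=> n; have [_ _ _ ->] := hk_ n.
Qed.

Variable k0 : XY -> R.
Hypothesis hk0 : real_density nu Q k0.

Lemma coupling_density_product : coupling_density k0.
Proof.
have [mk k0_ge0 kE] := hk0; split => // [A mA|B mB]; rewrite -kE;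
  try exact: measurableX.
  transitivity (rho A * mu setT); first exact: product_measure1E.
  by rewrite probability_setT mule1.
transitivity (rho setT * mu B); first exact: product_measure1E.
by rewrite probability_setT mul1e.
Qed.

Hypothesis k0lty : entropy_of Q k0 < +oo.

Lemma coupling_minimizer_exists : exists k, coupling_density k /\
  forall h, coupling_density h -> entropy_of Q k <= entropy_of Q h.
Proof.
apply: (@minimizer_exists _ _ _ Q [set k | coupling_density k] k0) => //.
- exact: coupling_density_unit_mass.
- move=> h k hh hk; have := @coupling_density_convex (2^-1) h k _ hh hk.
  rewrite invr_gt0 ltr0n invf_lt1 ?ltr1n//= => /(_ erefl).
  congr coupling_density; apply/funext => z; rewrite /midpoint.
  by field.
- by move=> k_ k h1 h2 h3 h4; exact: coupling_density_limit h1 h2 h3 h4.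
- exact: coupling_density_product.
Qed.

Variable k : XY -> R.
Hypothesis hk : coupling_density k.
Hypothesis kmin : forall h, coupling_density h -> entropy_of Q k <= entropy_of Q h.

(** The product coupling is the competitor. *)
Lemma coupling_minimizer_gt0 : {ae nu, forall z, (0 < k z)%R}.
Proof.
apply: (minimizer_gt0 (coupling_density_unit_mass hk) hk0 k0lty).
  by apply: kmin; exact: coupling_density_product.
move=> t t01; apply: kmin; apply: coupling_density_convex => //.
exact: coupling_density_product.
Qed.

(** Where k, 1 / k and k0 are bounded, small bounded perturbations keep the density
    nonnegative and the entropy finite. *)
Let S_ (n : nat) : set XY :=
  [set z | [&& (n.+1%:R^-1 <= k z)%R, (`|ln (k z)| <= n.+1%:R)%R &
            (k0 z <= n.+1%:R)%R]].

Let measurable_S n : measurable (S_ n).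
Proof.
have [mk _ _ _] := hk; have [mk0 _ _] := hk0.
have mlnk : measurable_fun setT (fun z => `|ln (k z)|%R).
  by apply: measurableT_comp => //; exact: measurableT_comp.
rewrite -[X in measurable X]setTI.
have mb : measurable_fun setT (fun z => [&& (n.+1%:R^-1 <= k z)%R,
    (`|ln (k z)| <= n.+1%:R)%R & (k0 z <= n.+1%:R)%R]).
  by apply: measurable_and; [|apply: measurable_and]; exact: measurable_fun_ler.
exact: (mb measurableT [set true]).
Qed.

(** A bounded t with zero marginals with respect to nu yields the perturbation
    t k0 of k, as densities here are taken with respect to Q and nu = k0 Q.
    Apply [first_variation] on each S_n; they exhaust the set where k > 0. *)
Lemma coupling_minimizer_cross_ratio :
  {ae nu2, forall w, [/\ 0 < k w.1, 0 < k w.2, 0 < k (exchange_snd w).1 &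
      0 < k (exchange_snd w).2]%R ->
    (k w.1 * k w.2 = k (exchange_snd w).1 * k (exchange_snd w).2)%R}.
Proof.
have [mk k_ge0 kA kB] := hk; have [mk0 k0_ge0 _] := hk0.
have mlnk : measurable_fun setT (fun z => ln (k z)).
  exact: measurableT_comp.
have ex_inv C : measurable C -> nu2 C = nu2 (@exchange_snd _ _ X Y @^-1` C).
  exact: exchange_snd_invariant.
have cross n : {ae nu2, forall w, quad (S_ n) w ->
    (ln (k w.1) + ln (k w.2) =
     ln (k (exchange_snd w).1) + ln (k (exchange_snd w).2))%R}.
  apply: (cross_difference_zero ex_inv (measurable_S n) mlnk (L := n.+1%:R)).
    by move=> z /and3P[].
  move=> t mt [M tM] t0 tA tB.
  have M0 : (0 <= M)%R by apply: le_trans (tM point); exact: normr_ge0.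
  pose C : R := (M * n.+1%:R + 1)%R.
  have C0 : (0 < C)%R by rewrite ltr_wpDl// mulr_ge0.
  pose h z := (t z * k0 z)%R.
  have mh : measurable_fun setT h by exact: measurable_funM.
  have tS z : t z != 0%R -> S_ n z.
    by move=> tz; apply: contrapT => /t0 tz0; move: tz; rewrite tz0 eqxx.
  have hC z : (`|h z| <= C)%R.
    rewrite /h; have [->|tz] := eqVneq (t z) 0%R.
      by rewrite mul0r normr0 ltW.
    have /and3P[_ _ k0n] := tS _ tz.
    apply: (@le_trans _ _ (M * n.+1%:R)%R); last by rewrite lerDl.
    by rewrite normrM ler_pM// ger0_norm.
  have hQ (g : XY -> R) : measurable_fun setT g ->
      \int[Q]_z (h z * g z)%:E = \int[nu]_z (t z * g z)%:E.
    move=> mg; have mtg : measurable_fun setT (fun z => (t z * g z)%R).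
      exact: measurable_funM.
    rewrite (real_density_integral_real hk0 mtg).
    by apply: eq_integral => z _; rewrite /h; congr _%:E; ring.
  rewrite -(hQ _ mlnk).
  apply: (first_variation (coupling_density_unit_mass hk) _ mh (K := n.+1%:R) _ C0 hC).
  - apply: le_lt_trans k0lty; apply: kmin; exact: coupling_density_product.
  - by rewrite ltr0n.
  - move=> z hz; have /tS/and3P[? ? ?] : t z != 0%R.
      by apply: contraNneq hz => tz; rewrite /h tz mul0r.
    by split.
  - move=> e e0 he; apply: kmin.
    have ik := coupling_density_integrable hk.
    have ih : Q.-integrable setT (EFin \o (fun z => e * h z)%R).
      apply: (@bounded_integrable _ _ _ Q _ (e * C)%R).
        exact: measurable_funM.
      by move=> z; rewrite normrM (ger0_norm (ltW e0)) ler_pM2l.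
    have pert D r : measurable D -> \int[Q]_(z in D) (k z)%:E = r ->
        \int[nu]_z (t z * \1_D z)%:E = 0 ->
        \int[Q]_(z in D) (k z - e * h z)%:E = r.
      move=> mD kr tD.
      have hD0 : \int[Q]_(z in D) (e * h z)%:E = 0.
        have m1 : measurable_fun setT (fun z => \1_D z : R) by exact: measurable_indic.
        have ihz : Q.-integrable D (EFin \o h).
          apply: (integrableS measurableT) => //.
          exact: (@bounded_integrable _ _ _ Q _ C).
        under eq_integral do rewrite EFinM.
        rewrite integralZl// (_ : \int[Q]_(z in D) _ = 0) ?mule0//.
        rewrite -tD -hQ// integral_mkcond; apply: eq_integral => z _.
        by rewrite patchE indicE; case: ifPn; rewrite ?mulr1 ?mulr0.
      have ikD := integrableS measurableT mD (@subsetT _ D) ik.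
      have ihD := integrableS measurableT mD (@subsetT _ D) ih.
      have := integralB_EFin mD ikD ihD.
      by rewrite /= hD0 kr sube0.
    split => //.
    + by apply: measurable_funB => //; exact: measurable_funM.
    + move=> A mA; apply: pert; [exact: measurableX|exact: kA|].
      rewrite -(tA _ mA); apply: eq_integral => z _; congr (_ * _)%:E.
      rewrite !indicE; congr (_ : bool)%:R; apply/idP/idP; rewrite !inE.
        by case.
      by split.
    + move=> B mB; apply: pert; [exact: measurableX|exact: kB|].
      rewrite -(tB _ mB); apply: eq_integral => z _; congr (_ * _)%:E.
      rewrite !indicE; congr (_ : bool)%:R; apply/idP/idP; rewrite !inE.
        by case.
      by split.
apply: filterS (ae_foralln cross) => w cw [k1 k2 k3 k4].
have Sex z : (0 < k z)%R -> exists n, forall m, (n <= m)%N -> S_ m z.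
  move=> kz; pose b := (Num.max (k z)^-1 (Num.max `|ln (k z)| (k0 z)))%R.
  exists (Num.truncn b) => m nm.
  have bm : (b <= m.+1%:R)%R.
    by rewrite ltW// (lt_le_trans (truncnS_gt b))// ler_nat.
  move: bm; rewrite /b !ge_max => /and3P[b1 b2 b3]; apply/and3P; split => //.
  by rewrite -[leRHS]invrK lef_pV2 ?posrE ?invr_gt0.
have [n1 h1] := Sex _ k1; have [n2 h2] := Sex _ k2.
have [n3 h3] := Sex _ k3; have [n4 h4] := Sex _ k4.
have /(_ (maxn (maxn n1 n2) (maxn n3 n4))) := cw.
have q : quad (S_ (maxn (maxn n1 n2) (maxn n3 n4))) w.
  split; [apply: h1|apply: h2|apply: h3|apply: h4]; rewrite !leq_max leqnn ?orbT//.
move/(_ q); rewrite -!lnM ?posrE//; apply: ln_inj; rewrite posrE mulr_gt0//.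
Qed.

(** By Fubini there is a point z0 = (x0, y0) for which the cross ratio identity
    holds with almost every z, and k > 0 on almost all of both lines through z0;
    then k(x, y) = (k(x, y0) / k z0) k(x0, y). *)
Lemma coupling_minimizer_factorizes : exists (f : X -> R) (g : Y -> R),
  [/\ measurable_fun setT f, measurable_fun setT g,
      (forall x, (0 <= f x)%R), (forall y, (0 <= g y)%R) &
      {ae nu, forall z, (k z = f z.1 * g z.2)%R}].
Proof.
have [mk k_ge0 _ _] := hk.
have kpos := coupling_minimizer_gt0.
have [z0 [[kz0 kx0] [ky0 kcross]]] : exists z0, ((0 < k z0)%R /\
    {ae mu, forall y, (0 < k (z0.1, y))%R}) /\
    ({ae rho, forall x, (0 < k (x, z0.2))%R} /\
    {ae nu, forall z, [/\ 0 < k z0, 0 < k z, 0 < k (z0.1, z.2) & 0 < k (z.1, z0.2)]%R ->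
      (k z0 * k z = k (z0.1, z.2) * k (z.1, z0.2))%R}).
  apply: (@ae_exists _ _ _ nu).
  have h1 : {ae nu, forall z0, {ae mu, forall y, (0 < k (z0.1, y))%R}}.
    exact: ae_fst (ae_xsection kpos).
  have h2 : {ae nu, forall z0, {ae rho, forall x, (0 < k (x, z0.2))%R}}.
    exact: ae_snd (ae_ysection kpos).
  have h3 := ae_xsection coupling_minimizer_cross_ratio.
  by apply: filterS2 (filterI kpos h1) (filterI h2 h3) => z0 ? ?.
exists (fun x => k (x, z0.2) / k z0)%R, (fun y => k (z0.1, y)); split => //.
- apply: measurable_funM => //.
  exact: (measurableT_comp mk (pair2_measurable z0.2)).
- by apply: measurableT_comp => //; exact: pair1_measurable.
- by move=> x; rewrite divr_ge0.
- apply: filterS3 kcross (ae_fst mu ky0) (filterI kpos (ae_snd rho kx0)).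
  move=> z kc kz1 [kz kz2]; have {}kc := kc (And4 kz0 kz kz2 kz1).
  have : k z0 != 0%R by rewrite gt_eqF.
  by move=> n0; rewrite mulrAC -[RHS]mulrA; apply: (mulfI n0); rewrite kc; field.
Qed.

End schrodinger_factorization.

Section scaling.
Context {R : realType} {d d' : measure_display}.
Context {X : measurableType d} {Y : measurableType d'}.
Variables (rho : probability X R) (mu : probability Y R).

(** Freeze y0 such that f(x) g(y0) = f'(x) g'(y0) > 0 for almost every x: then f'
    is proportional to f.  Freezing some x0 gives the inverse factor for g'. *)
Lemma factors_unique_up_to_scaling (f f' : X -> R) (g g' : Y -> R) :
  (forall y, 0 <= g y) -> (forall y, 0 <= g' y) ->
  {ae (rho \x mu)%E, forall z, 0 < f z.1 * g z.2} ->
  {ae (rho \x mu)%E, forall z, f z.1 * g z.2 = f' z.1 * g' z.2} ->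
  exists2 c : R, 0 < c & {ae rho, forall x, f' x = c * f x} /\
    {ae mu, forall y, g' y = c^-1 * g y}.
Proof.
move=> g0 g'0 pos eqfg; have both : {ae (rho \x mu)%E, forall z,
    0 < f z.1 * g z.2 /\ f z.1 * g z.2 = f' z.1 * g' z.2}.
  by apply: filterS2 pos eqfg => z; split.
have [y0 hy0] := ae_exists (ae_ysection both).
have [x1 [/= px1 ex1]] := ae_exists hy0.
have gy0 : 0 < g y0.
  by rewrite lt_def g0 andbT; apply: contraTneq px1 => ->; rewrite mulr0 ltxx.
have g'y0 : 0 < g' y0.
  by rewrite lt_def g'0 andbT; apply: contraTneq px1; rewrite ex1 => ->; rewrite mulr0 ltxx.
have fae : {ae rho, forall x, f' x = g y0 / g' y0 * f x}.
  apply: filterS hy0 => x [/= _ e]; apply: (mulIf (lt0r_neq0 g'y0)).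
  by rewrite -e; field; rewrite gt_eqF.
exists (g y0 / g' y0); first exact: divr_gt0.
split => //; set c := g y0 / g' y0.
have c0 : c != 0 by rewrite gt_eqF// divr_gt0.
have [x0 [hx0 fx0]] : exists x0, {ae mu, forall y,
    0 < f x0 * g y /\ f x0 * g y = f' x0 * g' y} /\ f' x0 = c * f x0.
  apply: (@ae_exists _ _ _ rho).
  by apply: filterS2 (ae_xsection both) fae => x ? ?; split.
apply: filterS hx0 => y [/= px ex].
have fn0 : f x0 != 0 by apply: contraTneq px => ->; rewrite mul0r ltxx.
have f'n0 : f' x0 != 0 by rewrite fx0 mulf_neq0.
by apply: (mulfI f'n0); rewrite -ex fx0 -/c; field.
Qed.

End scaling.

Section strips.
Context {R : realType} {d d' : measure_display}.
Context {X : measurableType d} {Y : measurableType d'}.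
Local Open Scope ereal_scope.
Variables (rho : probability X R) (mu : probability Y R).
Variable H : X * Y -> \bar R.
Hypotheses (mH : measurable_fun setT H) (H0 : forall z, 0 <= H z).

Lemma integral_vertical_strip A : measurable A ->
  \int[rho \x mu]_(z in A `*` setT) H z = \int[rho]_(x in A) \int[mu]_y H (x, y).
Proof.
move=> mA; have mA' : measurable (A `*` [set: Y]) by exact: measurableX.
have mHA := (measurable_restrictT H mA').1 (measurable_funTS mH).
have HA0 z : 0 <= (H \_ (A `*` [set: Y])) z by exact: erestrict_ge0.
rewrite integral_mkcond (@fubini_tonelli1 _ _ _ _ _ rho mu _ mHA HA0).
rewrite [RHS]integral_mkcond; apply: eq_integral => x _; rewrite /fubini_F patchE.
case: ifPn => xA.
  apply: eq_integral => y _; rewrite patchE ifT//.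
  by rewrite inE; split => //; exact/set_mem.
apply: integral0_eq => y _; rewrite patchE ifF//; apply/negP.
by rewrite inE => -[/= ? _]; move/negP: xA; apply; exact/mem_set.
Qed.

Lemma integral_horizontal_strip B : measurable B ->
  \int[rho \x mu]_(z in setT `*` B) H z = \int[mu]_(y in B) \int[rho]_x H (x, y).
Proof.
move=> mB; have mB' : measurable ([set: X] `*` B) by exact: measurableX.
have mHB := (measurable_restrictT H mB').1 (measurable_funTS mH).
have HB0 z : 0 <= (H \_ ([set: X] `*` B)) z by exact: erestrict_ge0.
rewrite integral_mkcond (@fubini_tonelli2 _ _ _ _ _ rho mu _ mHB HB0).
rewrite [RHS]integral_mkcond; apply: eq_integral => y _; rewrite /fubini_G patchE.
case: ifPn => yB.
  apply: eq_integral => x _; rewrite patchE ifT//.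
  by rewrite inE; split => //; exact/set_mem.
apply: integral0_eq => x _; rewrite patchE ifF//; apply/negP.
by rewrite inE => -[_ /= ?]; move/negP: yB; apply; exact/mem_set.
Qed.

Lemma density_eq1 (G : X -> \bar R) : measurable_fun setT G ->
  (forall A, measurable A -> rho A = \int[rho]_(x in A) G x) ->
  {ae rho, forall x, 1 = G x}.
Proof.
move=> mG GE.
have i1 : rho.-integrable setT (fun=> 1 : \bar R).
  exact: finite_measure_integrable_cst.
have h : ae_eq rho setT (fun=> 1) G.
  apply: integral_ae_eq => // A _ mA.
  by rewrite -GE// integral_cst// mul1e.
by apply: filterS h => x /(_ I).
Qed.

End strips.

(** * Supports and couplings *)

Section countable_base.
Context {R : realType} {n m : nat}.
Local Notation E := (state R n m).
Local Open Scope ereal_scope.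

Definition rational_ball (q : 'rV[rat]_n) (r : nat) : set 'rV[R]_n :=
  ball (map_mx ratr q : 'rV[R]_n) (r.+1%:R^-1 : R).

Lemma open_rational_ball q r : open (rational_ball q r).
Proof. by apply: ball_open; rewrite invr_gt0. Qed.

Lemma measurable_rational_ball q r : measurable (rational_ball q r).
Proof. by apply: sub_sigma_algebra; exact: open_rational_ball. Qed.

(** Balls with rational centres and radii 1 / (r + 1) are a base of the topology;
    the radius is shared by the two points for use in a product. *)
Lemma rational_ball_basis (x y : 'rV[R]_n) (U V : set 'rV[R]_n) :
  nbhs x U -> nbhs y V -> exists p q r,
    [/\ rational_ball p r x, rational_ball p r `<=` U,
        rational_ball q r y & rational_ball q r `<=` V].
Proof.
move=> /nbhs_ballP[e e0 xU] /nbhs_ballP[e' e'0 yV].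
pose del := (Num.min e e' / 2)%R.
have del0 : (0 < del)%R by rewrite divr_gt0// lt_min e0.
pose r := Num.truncn del^-1.
have rdel : (r.+1%:R^-1 < del :> R)%R.
  by rewrite -[ltRHS]invrK ltf_pV2 ?posrE ?invr_gt0//; exact: truncnS_gt.
have r0 : (0 < r.+1%:R^-1 :> R)%R by rewrite invr_gt0.
have approx (z : 'rV[R]_n) : exists p : 'rV[rat]_n, rational_ball p r z.
  have /choice[p hp] j : exists q : rat, (`|z 0%R j - ratr q| < r.+1%:R^-1)%R.
    have [q /[!in_itv]/= /andP[q1 q2]] :=
      @rat_in_itvoo R (z 0%R j - r.+1%:R^-1) (z 0%R j + r.+1%:R^-1)%R
      ltac:(by rewrite ltrBlDr -addrA ltrDl addr_gt0).
    by exists q; rewrite ltr_distl ltrBlDr q2 -ltrBlDr q1.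
  exists (\row_j p j); split => // i j; rewrite !mxE (ord1 i).
  by rewrite /ball/= distrC.
have sub (z : 'rV[R]_n) p a (A : set 'rV[R]_n) : (0 < a)%R -> ball z a `<=` A ->
    (del * 2 <= a)%R -> rational_ball p r z -> rational_ball p r `<=` A.
  move=> a0 zA da pz w pw; apply: zA; apply: le_ball da _ _.
  rewrite mulr_natr mulr2n; apply: ball_triangle (le_ball (ltW rdel) pw).
  by apply: ball_sym; apply: le_ball pz; exact: ltW.
have d2 : (del * 2 = Num.min e e')%R by rewrite /del divfK.
have [p px] := approx x; have [q qy] := approx y.
exists p, q, r; split => //.
  by apply: (sub x p e U e0 xU) px; rewrite d2 ge_min lexx.
by apply: (sub y q e' V e'0 yV) qy; rewrite d2 ge_min lexx orbT.
Qed.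

(** A point is outside the support iff it belongs to a null set of the countable
    base of rectangles; bases indexed by nat are padded with empty sets. *)
Lemma msupport_setC (mu : {measure set (E * 'rV[R]_n) -> \bar R}) :
  exists (A : nat -> set E) (B : nat -> set 'rV[R]_n),
    [/\ forall k, measurable (A k), forall k, measurable (B k),
        forall k, mu (A k `*` B k) = 0 &
        ~` msupport mu = \bigcup_k (A k `*` B k)].
Proof.
pose I : countType := ('rV[rat]_n * 'I_m.+1 * 'rV[rat]_n * nat)%type.
have [u hu] : exists u : nat -> option I, forall s, exists k, u k = Some s.
  by exists unpickle => s; exists (pickle s); rewrite pickleK.
pose bA (s : I) : set E := rational_ball s.1.1.1 s.2 `*` [set s.1.1.2].
pose bB (s : I) : set 'rV[R]_n := rational_ball s.1.2 s.2.
have mA s : measurable (bA s).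
  by apply: measurableX => //; exact: measurable_rational_ball.
have mB s : measurable (bB s) by exact: measurable_rational_ball.
have ob s : open (bA s `*` bB s).
  rewrite openE => -[[x i] y] [/= [/= px ->] qy].
  exists (bA s, bB s) => //=; split.
    exists (rational_ball s.1.1.1 s.2, [set s.1.1.2]) => //=; split => //.
    by apply: open_nbhs_nbhs; split => //; exact: open_rational_ball.
  by apply: open_nbhs_nbhs; split => //; exact: open_rational_ball.
have basis z V : nbhs z V -> exists s, (bA s `*` bB s) z /\ bA s `*` bB s `<=` V.
  case: z => -[x i] y [[P P2] /= [[[P3 P4] /= [xP3 iP4] P34] yP2] PV].
  have [p [q [r [px pU qy qV]]]] := rational_ball_basis xP3 yP2.
  exists (p, i, q, r); split; first by [].
  move=> [[x' i'] y'] [[/= px' ->] qy']; apply: PV; split => /=; last exact: qV.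
  apply: P34; split => /=; first exact: pU.
  exact: iP4.
have mV (V : set (E * 'rV[R]_n)) : open V -> measurable V.
  move=> oV.
  have -> : V =
    \bigcup_(k in [set k | if u k is Some s then bA s `*` bB s `<=` V else False])
      (if u k is Some s then bA s `*` bB s else set0).
    apply/seteqP; split => [z Vz|z [k /=]].
      have [s [sz sV]] := basis z V (open_nbhs_nbhs (conj oV Vz)).
      by have [k uk] := hu s; exists k; rewrite /= uk.
    by case: (u k) => // s sV sz; exact: sV.
  apply: bigcup_measurable => k _; case: (u k) => // s.
  exact: measurableX.
pose nul k := if u k is Some s then
  if mu (bA s `*` bB s) == 0 then Some s else None else None.
exists (fun k => if nul k is Some s then bA s else set0).
exists (fun k => if nul k is Some s then bB s else set0).
split.
- by move=> k; case: nul.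
- by move=> k; case: nul.
- move=> k; rewrite /nul; case: (u k) => [s|]; last by rewrite set0X measure0.
  by case: ifPn => [/eqP//|_]; rewrite set0X measure0.
- apply/seteqP; split => [z /= nz|z [k _]].
    have [V [oV [Vz V0]]] : exists V, open V /\ V z /\ mu V = 0.
      apply: contrapT => nV; apply: nz => V oV Vz; rewrite lt0e measure_ge0 andbT.
      by apply/eqP => V0; apply: nV; exists V.
    have [s [sz sV]] := basis z V (open_nbhs_nbhs (conj oV Vz)).
    have [k uk] := hu s; exists k => //; rewrite /nul uk.
    have -> : mu (bA s `*` bB s) = 0.
      apply: (subset_measure0 _ _ sV V0); last exact: mV.
      exact: measurableX.
    by rewrite eqxx.
  rewrite /nul; case: (u k) => [s|]; last by case.
  case: ifPn => [/eqP s0|_]; last by case.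
  by move=> sz /(_ _ (ob s) sz); rewrite s0 ltxx.
Qed.

End countable_base.

Section coupling_support.
Context {R : realType} {n m : nat}.
Local Notation E := (state R n m).
Local Open Scope ereal_scope.
Variables (rho : probability E R) (mup : probability 'rV[R]_n R).

Lemma measurable_msupport : measurable (msupport (rho \x mup)).
Proof.
have [A [B [mA mB _ DE]]] := msupport_setC (rho \x mup).
rewrite -[msupport _]setCK DE; apply: measurableC.
by apply: bigcup_measurable => k _; exact: measurableX.
Qed.

(** If rho A * mup B = 0 then A or B is null, and a coupling gives A x B at most
    the smaller of the two masses. *)
Lemma coupling_msupport (gamma : probability (E * 'rV[R]_n)%type R) :
  (forall A, measurable A -> gamma (A `*` setT) = rho A) ->
  (forall B, measurable B -> gamma (setT `*` B) = mup B) ->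
  gamma (~` msupport (rho \x mup)) = 0.
Proof.
move=> gA gB; have [A [B [mA mB AB0 DE]]] := msupport_setC (rho \x mup).
have mAB k : measurable (A k `*` B k) by exact: measurableX.
have mD := measurableC measurable_msupport.
apply/(negligibleP _ mD); rewrite DE; apply: negligible_bigcup => k.
apply/negligibleP => //.
have : rho (A k) * mup (B k) = 0.
  transitivity ((rho \x mup) (A k `*` B k)); last exact: AB0.
  by apply/esym; exact: product_measure1E.
move=> /eqP; rewrite mule_eq0 => /orP[]/eqP z0.
  apply: (@subset_measure0 _ _ _ _ _ (A k `*` setT)) => //.
  - exact: measurableX.
  - by apply: setSX.
  - by transitivity (rho (A k)); [exact: gA|exact: z0].
apply: (@subset_measure0 _ _ _ _ _ (setT `*` B k)) => //.
- exact: measurableX.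
- by apply: setSX.
- by transitivity (mup (B k)); [exact: gB|exact: z0].
Qed.

End coupling_support.

(** * Regime components *)

Section components.
Context {R : realType} {n m : nat}.
Local Notation E := (state R n m).
Local Open Scope ereal_scope.

Lemma measurable_regime (d : measure_display) (V : measurableType d)
  (f : 'I_m.+1 -> 'rV[R]_n -> V) : (forall i, measurable_fun setT (f i)) ->
  measurable_fun setT (fun e : E => f e.2 e.1).
Proof.
move=> mf _ B mB; rewrite setTI.
have -> : (fun e : E => f e.2 e.1) @^-1` B =
    \bigcup_(i in [set: 'I_m.+1]) ((f i @^-1` B) `*` [set i]).
  apply/seteqP; split => [[x i] /= fB|[x i] [j _ [/= fB ->]]//].
  by exists i.
apply: fin_bigcup_measurable => // i _; apply: measurableX => //.
by rewrite -[X in measurable X]setTI; exact: mf.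
Qed.

Section one_measure.
Variable rho : probability E R.

Lemma ae_component i (P : E -> Prop) : {ae rho, forall z, P z} ->
  {ae component rho i, forall x, P (x, i)}.
Proof.
move=> [N [mN N0 PN]]; pose M := [set x : 'rV[R]_n | N (x, i)].
have mM : measurable M.
  by rewrite -[X in measurable X]setTI; exact: (pair2_measurable i measurableT mN).
exists M; split => //; last by move=> x /= Px; exact: PN.
apply: (@subset_measure0 _ _ _ rho (M `*` [set i]) N) => //.
  exact: measurableX.
by move=> [x j] [/= Mx ->].
Qed.

(** rho is the sum over i of the images of its components under x |-> (x, i). *)
Lemma integral_components (F : E -> \bar R) : measurable_fun setT F ->
  (forall z, 0 <= F z) ->
  \int[rho]_z F z = \sum_(i < m.+1) \int[component rho i]_x F (x, i).
Proof.
move=> mF F0.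
pose inj (j : nat) (x : 'rV[R]_n) : E := (x, inord j).
have minj j : measurable_fun setT (inj j) by exact: pair2_measurable.
pose m_ (j : nat) : {measure set E -> \bar R} :=
  measure_function_pushforward__canonical__measure_function_Measure
    (component rho (inord j)) (minj j).
transitivity (\int[msum m_ m.+1]_z F z).
  apply: eq_measure_integral => A mA _.
  pose A_ (i : 'I_m.+1) : set E := [set x | A (x, i)] `*` [set i].
  have mA_ i : measurable (A_ i).
    apply: measurableX => //; rewrite -[X in measurable X]setTI.
    exact: (pair2_measurable i measurableT mA).
  have AE : A = \big[setU/set0]_(i < m.+1) A_ i.
    rewrite -bigcup_mkord_ord; apply/seteqP.
    split => [[x i] Axi|[x i] [j _ [/= + ->]]//].
    by exists i => //=; rewrite inord_val.
  have AS : rho A = \sum_(i < m.+1) rho (A_ i).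
    rewrite [X in rho X]AE measure_semi_additive_ord//.
      apply/trivIsetP => i j _ _; apply: contra_neqP => /eqP/set0P[[x k]].
      by move=> [[/= _ ->] [/= _ ->]].
    by rewrite -AE.
  transitivity (\sum_(i < m.+1) rho (A_ i)); first exact: AS.
  rewrite /msum; apply: eq_bigr => i _ /=.
  by rewrite /pushforward /component /inj inord_val.
rewrite ge0_integral_measure_sum//.
apply: eq_bigr => i _; rewrite ge0_integral_pushforward//.
by rewrite preimage_setT /inj /comp/= inord_val.
Qed.

End one_measure.
End components.

Section component_products.
Context {R : realType} {n m : nat}.
Local Notation E := (state R n m).
Local Open Scope ereal_scope.
Variables (rho : probability E R) (mup : probability 'rV[R]_n R).
Implicit Types C : set ('rV[R]_n * 'rV[R]_n).

Definition slab (i : 'I_m.+1) C : set (E * 'rV[R]_n) :=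
  [set w | w.1.2 = i /\ C (w.1.1, w.2)].

Lemma measurable_slab i C : measurable C -> measurable (slab i C).
Proof.
move=> mC.
have mp : measurable_fun setT (fun w : E * 'rV[R]_n => (w.1.1, w.2)).
  apply: measurable_fun_pair => //.
  by apply: measurableT_comp measurable_fst => //; exact: measurable_fst.
have mi : measurable_fun setT (fun w : E * 'rV[R]_n => w.1.2).
  by apply: measurableT_comp measurable_fst => //; exact: measurable_snd.
have -> : slab i C = (fun w => w.1.2) @^-1` [set i] `&`
    (fun w => (w.1.1, w.2)) @^-1` C by [].
apply: measurableI.
  by rewrite -[X in measurable X]setTI; exact: mi.
by rewrite -[X in measurable X]setTI; exact: mp.
Qed.

Lemma measurable_insert_regime i :
  measurable_fun setT (fun z : 'rV[R]_n * 'rV[R]_n => ((z.1, i), z.2) : E * 'rV[R]_n).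
Proof. by apply: measurable_fun_pair => //; apply: measurable_fun_pair. Qed.

Lemma integral_slab i C (F : E * 'rV[R]_n -> \bar R) : measurable C ->
  measurable_fun setT F -> (forall w, 0 <= F w) ->
  \int[rho \x mup]_(w in slab i C) F w =
  \int[component rho i \x mup]_(z in C) F ((z.1, i), z.2).
Proof.
move=> mC mF F0; have mS := measurable_slab i mC.
have mFS : measurable_fun setT (F \_ (slab i C)).
  exact: ((measurable_restrictT F mS).1 (measurable_funTS mF)).
have FS0 w : 0 <= (F \_ (slab i C)) w by exact: erestrict_ge0.
have mG : measurable_fun setT (fun z : 'rV[R]_n * 'rV[R]_n => F ((z.1, i), z.2)).
  exact: (measurableT_comp mF (measurable_insert_regime i)).
pose G := (fun z : 'rV[R]_n * 'rV[R]_n => F ((z.1, i), z.2)) \_ C.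
have mGC : measurable_fun setT G.
  exact: ((measurable_restrictT _ mC).1 (measurable_funTS mG)).
have GC0 z : 0 <= G z by apply: erestrict_ge0.
rewrite integral_mkcond [RHS]integral_mkcond.
rewrite (@fubini_tonelli1 _ _ _ _ _ rho mup _ mFS FS0).
rewrite (@fubini_tonelli1 _ _ _ _ _ (component rho i) mup _ mGC GC0).
have mFF : measurable_fun setT (fubini_F mup (F \_ (slab i C))).
  exact: measurable_fun_fubini_tonelli_F.
rewrite integral_components//; last first.
  by move=> z; apply: integral_ge0 => y _.
rewrite (bigD1 i)//= [X in _ + X]big1 ?adde0; last first.
  move=> j ji; apply: integral0_eq => x _; apply: integral0_eq => y _.
  by rewrite patchE memNset// => -[/= ji' _]; move: ji; rewrite ji' eqxx.
apply: eq_integral => x _; apply: eq_integral => y _.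
rewrite /G !patchE; congr (if _ then _ else _).
by apply/idP/idP; rewrite !inE; [case|split].
Qed.

End component_products.

(** * Observing the endpoint without its regime *)

Section observation.
Context {R : realType} {n m : nat}.
Local Notation E := (state R n m).

Definition observe (z : E * E) : E * 'rV[R]_n := (z.1, z.2.1).

Lemma measurable_observe : measurable_fun setT observe.
Proof.
apply: measurable_fun_pair => //.
by apply: measurableT_comp measurable_snd => //; exact: measurable_fst.
Qed.

HB.instance Definition _ :=
  isMeasurableFun.Build _ _ _ _ observe measurable_observe.

End observation.

Section partial_observation.
Context {R : realType} {n m : nat}.
Local Notation E := (state R n m).
Local Notation Y := 'rV[R]_n.
Local Open Scope ereal_scope.
Variables (rho : probability E R) (mup : probability Y R).
Variables (P0T : probability (E * E)%type R) (Q : probability (E * Y)%type R).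
Let nu : probability (E * Y)%type R := (rho \x mup).
Let D := msupport (rho \x mup).
Local Notation p := (@observe R n m).

Hypothesis hQ : forall B, measurable B -> Q B = P0T (p @^-1` B).

Variable pbar : 'I_m.+1 -> Y -> Y -> \bar R.
Let pb (w : E * Y) := pbar w.1.2 w.1.1 w.2.
Hypothesis hpb : is_density (restriction Q D) nu pb.

Let mD : measurable D := measurable_msupport rho mup.

Let nuA A : measurable A -> nu (A `*` setT) = rho A.
Proof.
move=> mA; transitivity (rho A * mup setT); first exact: product_measure1E.
by rewrite probability_setT mule1.
Qed.

Let nuB B : measurable B -> nu (setT `*` B) = mup B.
Proof.
move=> mB; transitivity (rho setT * mup B); first exact: product_measure1E.
by rewrite probability_setT mul1e.
Qed.

Let nu_support : {ae nu, forall w, D w}.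
Proof.
exists (~` D); split => //; first exact: measurableC.
exact: (coupling_msupport nuA nuB).
Qed.

Variable k0 : E * Y -> R.
Hypothesis hk0 : real_density nu Q k0.

(** Both sides integrate over A, with respect to Q, to the Q-mass of A inside the
    support: for pb k0 because nu = k0 Q. *)
Lemma reference_density_inverse :
  {ae Q, forall w, pb w * (k0 w)%:E = (\1_D w)%:E}.
Proof.
have [mpb pb0 pbE] := hpb; have [mk0 k0_ge0 _] := hk0.
have mk0E : measurable_fun setT (fun w => (k0 w)%:E) by exact/measurable_EFinP.
have iD : Q.-integrable setT (fun w => (\1_D w)%:E).
  by apply: integrable_indic.
have mg : measurable_fun setT (fun w => pb w * (k0 w)%:E).
  exact: emeasurable_funM.
have h : ae_eq Q setT (fun w => (\1_D w)%:E) (fun w => pb w * (k0 w)%:E).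
  apply: integral_ae_eq => // A _ mA.
  rewrite -(real_density_integral hk0 mA pb0); last exact: measurable_funTS.
  by rewrite -pbE// integral_indic// /restriction setIC.
by apply: filterS h => w /(_ I).
Qed.

Lemma reference_density_inverse_nu : {ae nu, forall w, pb w * (k0 w)%:E = 1}.
Proof.
have := dominates_ae (real_density_dominates hk0) reference_density_inverse.
move=> h; apply: filterS2 nu_support h => w Dw ->.
by rewrite indicE mem_set.
Qed.

Variable k : E * Y -> R.
Hypothesis hk : coupling_density rho mup Q k.
Variable gamma : probability (E * Y)%type R.
Hypothesis hgamma : real_density gamma Q k.

Let gammaA A : measurable A -> gamma (A `*` setT) = rho A.
Proof.
move=> mA; have [_ _ <- //] := hk.
by have [_ _ ->] := hgamma => //; exact: measurableX.
Qed.

Let gammaB B : measurable B -> gamma (setT `*` B) = mup B.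
Proof.
move=> mB; have [_ _ _ <- //] := hk.
by have [_ _ ->] := hgamma => //; exact: measurableX.
Qed.

Let mpb : measurable_fun setT pb. Proof. by case: hpb. Qed.
Let pb0 w : 0 <= pb w. Proof. by case: hpb. Qed.
Let mkE : measurable_fun setT (fun w => (k w)%:E).
Proof. by apply/measurable_EFinP; case: hk. Qed.
Let kE0 w : 0 <= (k w)%:E. Proof. by rewrite lee_fin; case: hk. Qed.

(** As gamma is carried by D, on which pb k0 = 1, one has
    k Q = k (pb k0) Q = k pb nu. *)
Lemma coupling_density_product_measure C : measurable C ->
  gamma C = \int[nu]_(w in C) ((k w)%:E * pb w).
Proof.
move=> mC; have [_ _ gE] := hgamma; have [mk0 k0_ge0 _] := hk0.
have mk0E : measurable_fun setT (fun w => (k0 w)%:E) by exact/measurable_EFinP.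
have gD : {ae gamma, forall w, D w}.
  exists (~` D); split => //; first exact: measurableC.
  exact: (coupling_msupport gammaA gammaB).
have mkpb : measurable_fun setT (fun w => (k w)%:E * pb w) by exact: emeasurable_funM.
have kpb0 w : 0 <= (k w)%:E * pb w by rewrite mule_ge0.
rewrite gE// (real_density_integral hk0 mC kpb0); last exact: measurable_funTS.
apply: ge0_ae_eq_integral => //.
- exact: measurable_funTS.
- by apply: measurable_funTS; exact: emeasurable_funM.
- by move=> w _; rewrite mule_ge0// lee_fin.
apply: filterS2 (real_density_ae hgamma gD) reference_density_inverse => w kD e _.
rewrite -muleA e; have [k_0|kw] := eqVneq (k w) 0%R; first by rewrite k_0 mul0e.
have Dw : D w by apply: kD; rewrite lt_def kw -lee_fin kE0.
by rewrite indicE mem_set// mule1.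
Qed.

Lemma coupling_dominated : gamma `<< nu.
Proof.
apply/null_content_dominatesP => C mC C0.
rewrite coupling_density_product_measure// null_set_integral//.
by apply: measurable_funTS; exact: emeasurable_funM.
Qed.

Hypothesis k_gt0 : {ae nu, forall w, (0 < k w)%R}.

(** With [coupling_dominated], gamma and nu have the same null sets. *)
Lemma ae_coupling_ae_product (P : E * Y -> Prop) :
  {ae gamma, forall w, P w} -> {ae nu, forall w, P w}.
Proof.
move=> /(real_density_ae hgamma)/(dominates_ae (real_density_dominates hk0)) h.
by apply: filterS2 k_gt0 h => w kw; apply.
Qed.

Variable pi : probability (E * E)%type R.
Hypothesis hpi : real_density pi P0T (k \o p).

Lemma lifted_couplingE B : measurable B -> gamma B = pi (p @^-1` B).
Proof.
move=> mB; have [_ _ gE] := hgamma; have [_ _ piE] := hpi.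
have mpB : measurable (p @^-1` B).
  by rewrite -[X in measurable X]setTI; exact: measurable_observe.
rewrite gE// piE//.
exact: (ge0_integral_image measurable_observe hQ mB (measurable_funTS mkE) kE0).
Qed.

Section factorization.
Variables (f : 'I_m.+1 -> Y -> R) (g : Y -> R).
Hypothesis hfg : nonneg_measurable f g.
Let F (e : E) := f e.2 e.1.

Let mF : measurable_fun setT F.
Proof. by apply: measurable_regime; case: hfg. Qed.
Let mg : measurable_fun setT g. Proof. by case: hfg. Qed.
Let F0 e : (0 <= F e)%R. Proof. by case: hfg => _ _ f0 _; exact: f0. Qed.
Let g0 y : (0 <= g y)%R. Proof. by case: hfg. Qed.

Let mFg : measurable_fun setT (fun w : E * Y => (F w.1 * g w.2)%R).
Proof. by apply: measurable_funM; exact: measurableT_comp. Qed.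

(** The density of pi is k composed with p, and an event on (Z_0, X_T) is pi-null
    iff it is gamma-null, iff it is nu-null. *)
Lemma factorizesP : factorizes P0T pi f g <->
  {ae nu, forall w, k w = (F w.1 * g w.2)%R}.
Proof.
have RNE := dominates_ae (real_density_dominates hpi) (RN_derivativeE hpi).
split=> [fg|kFg].
- apply: ae_coupling_ae_product.
  pose N := ~` [set w : E * Y | k w = (F w.1 * g w.2)%R].
  have mN : measurable N.
    apply: measurableC; rewrite -[X in measurable X]setTI.
    have [mk _ _ _] := hk.
    have := measurable_fun_eqr mk mFg.
    move=> /(_ measurableT [set true] I).
    rewrite (_ : _ @^-1` [set true] = [set w | k w = (F w.1 * g w.2)%R])//.
    by apply/seteqP; split => w /= /eqP.
  exists N; split => //; rewrite lifted_couplingE//.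
  have mpN : measurable (p @^-1` N).
    by rewrite -[X in measurable X]setTI; exact: measurable_observe.
  apply/(negligibleP _ mpN).
  have : {ae pi, forall z, k (p z) = (F (p z).1 * g (p z).2)%R}.
    by apply: filterS2 fg RNE => z -> [] <-.
  by [].
- have h : {ae gamma, forall w, k w = (F w.1 * g w.2)%R}.
    exact: dominates_ae coupling_dominated kFg.
  have h' : {ae pi, forall z, k (p z) = (F (p z).1 * g (p z).2)%R}.
    have [N [mN N0 PN]] := h; exists (p @^-1` N); split.
    + by rewrite -[X in measurable X]setTI; exact: measurable_observe.
    + by rewrite -lifted_couplingE.
    + by move=> z /= nz; apply: PN.
  by apply: filterS2 h' RNE => z kz ->; rewrite /= kz.
Qed.

Let mFE : measurable_fun setT (fun e => (F e)%:E).
Proof. exact/measurable_EFinP. Qed.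
Let mgE : measurable_fun setT (fun y => (g y)%:E).
Proof. exact/measurable_EFinP. Qed.
Let FE0 e : 0 <= (F e)%:E. Proof. by rewrite lee_fin. Qed.
Let gE0 y : 0 <= (g y)%:E. Proof. by rewrite lee_fin. Qed.
Let mF1 : measurable_fun setT (fun w : E * Y => (F w.1)%:E).
Proof. by apply: measurableT_comp mFE _; exact: measurable_fst. Qed.
Let mg2 : measurable_fun setT (fun w : E * Y => (g w.2)%:E).
Proof. by apply: measurableT_comp mgE _; exact: measurable_snd. Qed.
Let H w := (F w.1)%:E * pb w * (g w.2)%:E.
Let mH : measurable_fun setT H.
Proof. by apply: emeasurable_funM => //; exact: emeasurable_funM. Qed.
Let H0 w : 0 <= H w. Proof. by rewrite mule_ge0// mule_ge0. Qed.
Let mpbx e : measurable_fun setT (fun y => pb (e, y)).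
Proof. by apply: measurableT_comp mpb _; exact: pair1_measurable. Qed.
Let mpby y : measurable_fun setT (fun e => pb (e, y)).
Proof. by apply: measurableT_comp mpb _; exact: pair2_measurable. Qed.

Let gammaH C : {ae nu, forall w, k w = (F w.1 * g w.2)%R} -> measurable C ->
  gamma C = \int[nu]_(w in C) H w.
Proof.
move=> kFg mC; rewrite coupling_density_product_measure//.
apply: ge0_ae_eq_integral => //.
- by apply: measurable_funTS; exact: emeasurable_funM.
- exact: measurable_funTS.
- by move=> w _; rewrite mule_ge0.
by apply: filterS kFg => w -> _; rewrite /H EFinM muleAC.
Qed.

(** The first and second equations are the first and second marginals of
    f pb g nu = gamma, disintegrated by Fubini. *)
Lemma factorization_schrodinger_system :
  {ae nu, forall w, k w = (F w.1 * g w.2)%R} ->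
  schrodinger_system rho mup pbar f g.
Proof.
move=> kFg; split.
- move=> i.
  have mI : measurable_fun setT (fun e => \int[mup]_y (pb (e, y) * (g y)%:E)).
    apply: (@measurable_fun_fubini_tonelli_F _ _ _ _ _ mup
      (fun w => pb w * (g w.2)%:E)).
      exact: emeasurable_funM.
    by move=> w; rewrite mule_ge0.
  have : {ae rho, forall e, 1 = (F e)%:E * \int[mup]_y (pb (e, y) * (g y)%:E)}.
    apply: density_eq1; first exact: emeasurable_funM.
    move=> A mA; rewrite -gammaA// (gammaH kFg); last exact: measurableX.
    etransitivity; first exact: (integral_vertical_strip rho mup mH H0 mA).
    apply: eq_integral => e _; rewrite -ge0_integralZl//; last 2 first.
      by apply: emeasurable_funM.
      by move=> y _; rewrite mule_ge0.
    by apply: eq_integral => y _; rewrite /H muleA.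
  by move/(ae_component i).
- have mI : measurable_fun setT (fun y => \int[rho]_e (pb (e, y) * (F e)%:E)).
    apply: (@measurable_fun_fubini_tonelli_G _ _ _ _ _ rho
      (fun w => pb w * (F w.1)%:E)).
      exact: emeasurable_funM.
    by move=> w; rewrite mule_ge0.
  have : {ae mup, forall y, 1 = (g y)%:E * \int[rho]_e (pb (e, y) * (F e)%:E)}.
    apply: density_eq1; first exact: emeasurable_funM.
    move=> B mB; rewrite -gammaB// (gammaH kFg); last exact: measurableX.
    etransitivity; first exact: (integral_horizontal_strip rho mup mH H0 mB).
    apply: eq_integral => y _; rewrite -ge0_integralZl//; last 2 first.
      by apply: emeasurable_funM.
      by move=> e _; rewrite mule_ge0.
    by apply: eq_integral => e _; rewrite /H muleC [X in _ * X]muleC.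
  apply: filterS => y ->; rewrite integral_components//.
    by apply: emeasurable_funM.
  by move=> e; rewrite mule_ge0.
Qed.

(** The formula says that f pb g and k pb have the same integrals over the
    measurable parts of each regime, hence agree nu-a.e.; and pb is finite and
    nonzero nu-a.e., being the inverse of k0. *)
Lemma coupling_formulaP : coupling_formula rho mup pbar pi f g <->
  {ae nu, forall w, k w = (F w.1 * g w.2)%R}.
Proof.
have projE i C : measurable C ->
    coupling_component (projected_coupling pi) i C = gamma (slab i C).
  by move=> mC; rewrite lifted_couplingE//; exact: measurable_slab.
have slabH i C : measurable C -> \int[nu]_(w in slab i C) H w =
    \int[component rho i \x mup]_(z in C)
        ((f i z.1)%:E * pbar i z.1 z.2 * (g z.2)%:E).
  by move=> mC; exact: integral_slab mC mH H0.
split=> [formula|kFg i C mC].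
- have mkpb : measurable_fun setT (fun w => (k w)%:E * pb w) by exact: emeasurable_funM.
  have eqH i : {ae nu, forall w, slab i setT w -> (k w)%:E * pb w = H w}.
    apply: integral_ae_eq; first exact: measurable_slab.
    + apply/integrableP; split; first exact: measurable_funTS.
      under eq_integral do rewrite gee0_abs ?mule_ge0//.
      rewrite -coupling_density_product_measure; last exact: measurable_slab.
      by rewrite ltey_eq fin_num_measure//; exact: measurable_slab.
    + exact: measurable_funTS.
    + move=> S Si mS; pose C := [set z : Y * Y | S ((z.1, i), z.2)].
      have mC : measurable C.
        rewrite -[X in measurable X]setTI.
        exact: (measurable_insert_regime i measurableT mS).
      have -> : S = slab i C.
        apply/seteqP; split => [[[x j] y] Sw|[[x j] y] [/= -> //]].
        by have [/= ji _] := Si _ Sw; split => //=; rewrite /C /= -ji.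
      rewrite -coupling_density_product_measure ?slabH -?formula ?projE//.
      exact: measurable_slab.
  have : {ae nu, forall w, (k w)%:E * pb w = H w}.
    apply: filterS (ae_foralln (fun j => eqH (inord j))) => w /(_ w.1.2) h.
    by apply: h; split; rewrite ?inord_val.
  move=> h; apply: filterS2 h reference_density_inverse_nu => w; rewrite /H => e pk.
  have [k0_ge0 pb0w] : (0 <= k0 w)%R /\ 0 <= pb w by split => //; case: hk0.
  move: e pk pb0w; rewrite /H; case: (pb w) => [r| |] //= e pk _; last first.
    move: pk; move: k0_ge0; rewrite le_eqVlt => /predU1P[<-|k0w].
      by rewrite mule0 => /eqP; rewrite eq_sym onee_eq0.
    by rewrite gt0_mulye ?lte_fin.
  have r0 : r != 0%R.
    by apply/eqP => r0; move: pk; rewrite r0 mul0e => /eqP; rewrite eq_sym onee_eq0.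
  by move: e => [] e; apply: (mulIf r0); rewrite e; ring.
- by rewrite projE// (gammaH kFg) ?slabH//; exact: measurable_slab.
Qed.

End factorization.

End partial_observation.

Section lifting.
Context {R : realType} {n m : nat}.
Local Notation E := (state R n m).
Local Notation Y := 'rV[R]_n.
Local Notation p := (@observe R n m).
Local Open Scope ereal_scope.
Variables (rho : probability E R) (mup : probability Y R).
Variables (P0T : probability (E * E)%type R) (Q : probability (E * Y)%type R).
Hypothesis hQ : forall B, measurable B -> Q B = P0T (p @^-1` B).

Let preimage_fst (A : set E) : p @^-1` (A `*` setT) = [set z | A z.1].
Proof. by apply/seteqP; split => z /= => [[]|]. Qed.

Let preimage_snd (B : set Y) : p @^-1` (setT `*` B) = [set z | B z.2.1].
Proof. by apply/seteqP; split => z /= => [[]|]. Qed.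

(** The image of an admissible coupling under p is a coupling of rho and mup, with
    no larger entropy. *)
Lemma admissible_projection (pi : probability (E * E)%type R) h :
  real_density pi P0T h -> admissible rho mup pi ->
  exists k, coupling_density rho mup Q k /\ entropy_of Q k <= entropy_of P0T h.
Proof.
move=> hh [piA piB]; pose gamma := distribution pi p.
have dom : gamma `<< Q.
  apply/null_content_dominatesP => B mB B0.
  have mpB : measurable (p @^-1` B).
    by rewrite -[X in measurable X]setTI; exact: measurable_observe.
  have /null_content_dominatesP := real_density_dominates hh.
  by apply => //; transitivity (Q B); [exact/esym/hQ|exact: B0].
have [k hk] := exists_real_density dom; exists k; split.
  have [mk k0 kE] := hk; split => // [A mA|B mB].
    rewrite -kE; last exact: measurableX.
    by rewrite -piA// -preimage_fst.
  rewrite -kE; last exact: measurableX.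
  by rewrite -piB// -preimage_snd.
exact: (data_processing measurable_observe hQ _ hh hk).
Qed.

Variable k : E * Y -> R.
Hypothesis hk : coupling_density rho mup Q k.
Hypothesis klty : entropy_of Q k < +oo.
Hypothesis kmin :
  forall h, coupling_density rho mup Q h -> entropy_of Q k <= entropy_of Q h.

Lemma lift_integral (F : E * Y -> \bar R) : measurable_fun setT F ->
  (forall w, 0 <= F w) -> \int[P0T]_z F (p z) = \int[Q]_w F w.
Proof.
move=> mF F0.
by rewrite (ge0_integral_image measurable_observe hQ measurableT mF F0) preimage_setT.
Qed.

Lemma lift_unit_mass : unit_mass P0T (k \o p).
Proof.
have [mk k0 Ik] := coupling_density_unit_mass hk; split.
- by apply: measurableT_comp => //; exact: measurable_observe.
- by move=> z; exact: k0.
rewrite -Ik; apply: (@lift_integral (fun w => (k w)%:E)).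
  exact/measurable_EFinP.
by move=> w; rewrite lee_fin.
Qed.

Lemma lift_entropy : entropy_of P0T (k \o p) = entropy_of Q k.
Proof.
have [mk k0 _ _] := hk; apply: (@lift_integral (fun w => (phi (k w))%:E)).
  exact: measurable_phi_comp.
by move=> w; rewrite lee_fin phi_ge0.
Qed.

Variable pi : probability (E * E)%type R.
Hypothesis hpi : real_density pi P0T (k \o p).

Let pi_preimage B : measurable B -> pi (p @^-1` B) = \int[Q]_(w in B) (k w)%:E.
Proof.
move=> mB; have [mk k0 _ _] := hk; have [_ _ ->] := hpi.
  apply/esym/(ge0_integral_image measurable_observe hQ mB).
    by apply: measurable_funTS; exact/measurable_EFinP.
  by move=> w; rewrite lee_fin.
by rewrite -[X in measurable X]setTI; exact: measurable_observe.
Qed.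

Lemma lift_admissible : admissible rho mup pi.
Proof.
have [_ _ kA kB] := hk; split => [A mA|B mB].
  by rewrite -preimage_fst pi_preimage ?kA//; exact: measurableX.
by rewrite -preimage_snd pi_preimage ?kB//; exact: measurableX.
Qed.

Lemma lift_optimal : optimal P0T rho mup pi.
Proof.
have entE : relative_entropy pi P0T = entropy_of Q k.
  by rewrite (relative_entropyE hpi) -[LHS]/(entropy_of _ _) lift_entropy.
split; first exact: lift_admissible.
apply/eqP; rewrite eq_le; apply/andP; split; last first.
  by apply: ereal_inf_lbound; exists pi => //; exact: lift_admissible.
apply: le_ereal_inf_tmp => _ [pi' api' <-]; rewrite entE.
have [|] := ltP (relative_entropy pi' P0T) +oo; last first.
  by rewrite leye_eq => /eqP ->; rewrite leey.
move=> /relative_entropy_lty[h hh]; rewrite (relative_entropyE hh).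
have [k' [ck' k'h]] := admissible_projection hh api'.
exact: le_trans (kmin ck') k'h.
Qed.

(** The midpoint of two optimal densities is the density of an admissible
    coupling, so [minimizer_unique] applies. *)
Lemma lift_unique (pi' : probability (E * E)%type R) :
  optimal P0T rho mup pi' -> forall A, measurable A -> pi' A = pi A.
Proof.
move=> [[pi'A pi'B] pi'opt]; have [_ piopt] := lift_optimal.
have [piA piB] := lift_admissible.
have entE : relative_entropy pi P0T = entropy_of P0T (k \o p).
  exact: relative_entropyE.
have k'lty : relative_entropy pi' P0T < +oo.
  by rewrite pi'opt -piopt entE lift_entropy.
have [h hh] := relative_entropy_lty k'lty.
have ent'E : relative_entropy pi' P0T = entropy_of P0T h by exact: relative_entropyE.
have uh : unit_mass P0T h.
  by have [mh h0 _] := hh; split => //; exact: real_density_prob_integral hh.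
have uk := lift_unit_mass.
have [mh h0 hE] := hh; have [mk k0 kE] := hpi.
have vfin : entropy_of P0T (k \o p) \is a fin_num.
  by rewrite ge0_fin_numE ?entropy_of_ge0// lift_entropy.
have hkE : entropy_of P0T h = entropy_of P0T (k \o p).
  by rewrite -ent'E -entE pi'opt piopt.
pose mid := midpoint h (k \o p).
have mmid : measurable_fun setT mid.
  by apply: measurable_funM => //; exact: measurable_funD.
have mid0 z : (0 <= mid z)%R by rewrite divr_ge0// addr_ge0.
have midE A : measurable A ->
    \int[P0T]_(z in A) (mid z)%:E = (2^-1)%:E * (pi' A + pi A).
  move=> mA; rewrite hE// kE//.
  have mhA : measurable_fun A (fun z => (h z)%:E).
    by apply: measurable_funTS; exact/measurable_EFinP.
  have mkA : measurable_fun A (fun z => ((k \o p) z)%:E).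
    by apply: measurable_funTS; exact/measurable_EFinP.
  have hE0 z : 0 <= (h z)%:E by rewrite lee_fin.
  have kE0 z : 0 <= ((k \o p) z)%:E by rewrite lee_fin.
  rewrite -ge0_integralD// -ge0_integralZl_EFin//; last 2 first.
    by move=> z _; rewrite adde_ge0.
    exact: emeasurable_funD.
  by apply: eq_integral => z _; rewrite /mid /midpoint -EFinD -EFinM mulrC.
have half (r : \bar R) : r \is a fin_num -> (2^-1)%:E * (r + r) = r.
  by move=> rf; rewrite -(fineK rf) -EFinD -EFinM; congr _%:E; lra.
have umid : unit_mass P0T mid.
  split => //; rewrite midE//.
  by rewrite [pi' setT]probability_setT [pi setT]probability_setT half.
have [sigma hsigma] := probability_of_density umid.
have asigma : admissible rho mup sigma.
  have [_ _ sE] := hsigma; split => [A mA|B mB].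
    have mA' : measurable [set z : E * E | A z.1].
      rewrite -preimage_fst -[X in measurable X]setTI.
      by apply: measurable_observe => //; exact: measurableX.
    by rewrite sE// midE// pi'A// piA// half// fin_num_measure.
  have mB' : measurable [set z : E * E | B z.2.1].
    rewrite -preimage_snd -[X in measurable X]setTI.
    by apply: measurable_observe => //; exact: measurableX.
  by rewrite sE// midE// pi'B// piB// half// fin_num_measure.
have vmid : entropy_of P0T (k \o p) <= entropy_of P0T mid.
  rewrite -[X in _ <= X](relative_entropyE hsigma) -entE piopt.
  by apply: ereal_inf_lbound; exists sigma.
have hkae : {ae P0T, forall z, h z = (k \o p) z}.
  apply: (minimizer_unique (v := fine (entropy_of P0T (k \o p))) uh uk).
  - by rewrite fineK.
  - by rewrite fineK// hkE.
  - by rewrite fineK.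
move=> A mA; rewrite hE// kE//.
apply: ge0_ae_eq_integral => //.
- by apply: measurable_funTS; exact/measurable_EFinP.
- by apply: measurable_funTS; exact/measurable_EFinP.
- by move=> z _; rewrite lee_fin.
- by move=> z _; rewrite lee_fin.
by apply: filterS hkae => z -> _.
Qed.

End lifting.

(** * Existence, uniqueness and characterization of the optimal coupling *)

Theorem theorem2p16 (R : realType) (T : R) (hT : 0 < T)
    (n m : nat) (hn : (1 <= n)%N)
    (b : 'I_m.+1 -> R -> 'rV[R]_n -> 'rV[R]_n)
    (sigma : 'I_m.+1 -> R -> 'rV[R]_n -> 'M[R]_n)
    (lambda : 'I_m.+1 -> 'I_m.+1 -> R -> 'rV[R]_n -> R)
    (hlambda : forall i j t x, j != i -> t \in `[0, T] -> 0 <= lambda i j t x)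
    (P : probability (path_space T n m) R)
    (hP : regime_switching_law b sigma lambda P)
    (rho : probability ('rV[R]_n * 'I_m.+1)%type R)
    (mup : probability 'rV[R]_n R)
    (hH : (relative_entropy (rho \x mup)%E (observed_law P) < +oo)%E)
    (hac : restriction (observed_law P) (msupport (rho \x mup)%E)
             `<< (rho \x mup)%E)
    (pbar : 'I_m.+1 -> 'rV[R]_n -> 'rV[R]_n -> \bar R)
    (hpbar : is_density
       (restriction (observed_law P) (msupport (rho \x mup)%E))
       (rho \x mup)%E
       (fun z : ('rV[R]_n * 'I_m.+1) * 'rV[R]_n => pbar z.1.2 z.1.1 z.2)) :
  exists pi : probability
      (('rV[R]_n * 'I_m.+1) * ('rV[R]_n * 'I_m.+1))%type R,
    [/\ optimal (endpoint_law P) rho mup pi,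
        (forall pi', optimal (endpoint_law P) rho mup pi' ->
           forall A, measurable A -> pi' A = pi A),
        pi `<< endpoint_law P &
        [/\ exists f g, nonneg_measurable f g /\
              factorizes (endpoint_law P) pi f g,
            (forall f g f' g',
               nonneg_measurable f g -> factorizes (endpoint_law P) pi f g ->
               nonneg_measurable f' g' -> factorizes (endpoint_law P) pi f' g' ->
               scaling_equivalent rho mup f f' g g'),
            (forall f g,
               nonneg_measurable f g -> factorizes (endpoint_law P) pi f g ->
               schrodinger_system rho mup pbar f g) &
            (forall f g, nonneg_measurable f g ->
               (factorizes (endpoint_law P) pi f g <->
                coupling_formula rho mup pbar pi f g))]].
Proof.
set P0T := endpoint_law P; set Q := observed_law P.
pose nu : probability (state R n m * 'rV[R]_n)%type R := (rho \x mup)%E.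
have hQ B : measurable B -> Q B = P0T (@observe R n m @^-1` B) by [].
have [k0 hk0] := relative_entropy_lty hH.
have k0lty : (entropy_of Q k0 < +oo)%E.
  by move: hH; rewrite (relative_entropyE hk0).
have [k [hk kmin]] := coupling_minimizer_exists hk0 k0lty.
have k_gt0 := coupling_minimizer_gt0 hk0 k0lty hk kmin.
have klty : (entropy_of Q k < +oo)%E.
  by apply: le_lt_trans k0lty; apply: kmin; exact: coupling_density_product.
have [gamma hgamma] := probability_of_density (coupling_density_unit_mass hk).
have [pi hpi] := probability_of_density (lift_unit_mass hQ hk).
have facP f g (hfg : nonneg_measurable f g) :=
  factorizesP hQ hpbar hk0 hk hgamma k_gt0 hpi hfg.
exists pi; split.
- exact: (lift_optimal hQ hk kmin hpi).
- exact: (lift_unique hQ hk klty kmin hpi).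
- exact: real_density_dominates hpi.
split.
- have [F [g [mF mg F0 g0 kFg]]] := coupling_minimizer_factorizes hk0 k0lty hk kmin.
  have hfg : nonneg_measurable (fun i x => F (x, i)) g.
    split => // i; exact: (measurableT_comp mF (pair2_measurable i)).
  exists (fun i x => F (x, i)), g; split => //; apply/(facP _ _ hfg).
  by apply: filterS kFg => -[[x i] y].
- move=> f g f' g' hfg /(facP _ _ hfg) kfg hfg' /(facP _ _ hfg') kfg'.
  have [_ _ _ g0] := hfg; have [_ _ _ g'0] := hfg'.
  have pos : {ae nu, forall w, 0 < f w.1.2 w.1.1 * g w.2}.
    by apply: filterS2 k_gt0 kfg => w + <-.
  have eqfg : {ae nu, forall w, f w.1.2 w.1.1 * g w.2 = f' w.1.2 w.1.1 * g' w.2}.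
    by apply: filterS2 kfg kfg' => w <- <-.
  have [c c0 [fc gc]] := @factors_unique_up_to_scaling _ _ _ _ _ rho mup
    (fun e => f e.2 e.1) (fun e => f' e.2 e.1) g g' g0 g'0 pos eqfg.
  by exists c => //; split => // i; exact: (ae_component i fc).
- move=> f g hfg /(facP _ _ hfg) kfg.
  exact: (factorization_schrodinger_system hpbar hk0 hk hgamma hfg kfg).
- move=> f g hfg; apply: (iff_trans (facP _ _ hfg)); apply: iff_sym.
  exact: (coupling_formulaP hQ hpbar hk0 hk hgamma hpi hfg).
Qed.
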